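(* Let $t\in\mathfrak o^\times$, $\chi=\chi_{1,1,t}$ (trivial central character), and let $f^\pm_{\rm new}$ and $f^\pm_{\rm min}$ be the newvector and the minimal vector in $\sigma_\chi^\pm$. For $u,v\in\mathfrak o^\times$, $x\in\mathfrak o$ and $y\in F$ put $$m(u,v)=\mathrm{diag}(uv,u,v,1),\quad \delta=\mathrm{diag}(1,\varpi,\varpi^2,\varpi^3),\quad \ell(x)=\begin{bmatrix}1\\&1\\&x&1\\&&&1\end{bmatrix},\quad n(y)=\begin{bmatrix}1&&&y\\&1\\&&1\\&&&1\end{bmatrix},$$ $$w_1=\begin{bmatrix}1\\&&-1\\&1\\&&&1\end{bmatrix},\quad w_2=\begin{bmatrix}&&&-\varpi^{-5}\\&&-1\\&1\\\varpi^5\end{bmatrix},\quad w_3=\begin{bmatrix}&&&-\varpi^{-5}\\&1\\&&1\\\varpi^5\end{bmatrix}.$$ Then $$\begin{aligned}f^\pm_{\rm new}=&\sum_{u,v\in(\mathfrak o/\mathfrak p)^\times}\ \sum_{\substack{x\in\mathfrak o/\mathfrak p^2\\ y\in\mathfrak o/\mathfrak p^2}}\sigma_\chi^\pm\big(w_1\,n(y\varpi^{-5})\,\ell(x)\,m(u,v)\,\delta\big)f^\pm_{\rm min}\\ &+\sum_{u,v\in(\mathfrak o/\mathfrak p)^\times}\ \sum_{\substack{x\in\mathfrak o/\mathfrak p\\ y\in\mathfrak o/\mathfrak p^2}}\sigma_\chi^\pm\big(n(y\varpi^{-5})\,\ell(x\varpi)\,m(u,v)\,\delta\big)f^\pm_{\rm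 min}\\ &+\sum_{u,v\in(\mathfrak o/\mathfrak p)^\times}\ \sum_{\substack{x\in\mathfrak o/\mathfrak p^2\\ z\in\mathfrak o/\mathfrak p}}\sigma_\chi^\pm\big(w_2\,n(z\varpi^{-4})\,\ell(x)\,m(u,v)\,\delta\big)f^\pm_{\rm min}\\ &+\sum_{u,v\in(\mathfrak o/\mathfrak p)^\times}\ \sum_{\substack{x\in\mathfrak o/\mathfrak p\\ z\in\mathfrak o/\mathfrak p}}\sigma_\chi^\pm\big(w_3\,n(z\varpi^{-4})\,\ell(x\varpi)\,m(u,v)\,\delta\big)f^\pm_{\rm min}.\end{aligned}$$
   Context: $F$ is a non-archimedean local field of characteristic zero with ring of integers $\mathfrak o$, maximal ideal $\mathfrak p$, uniformizer $\varpi$. $\psi$ is a character of $F$ trivial on $\mathfrak o$ but not on $\mathfrak p^{-1}$, and $\psi_0(x)=\psi(\varpi^{-1}x)$. $G=\mathrm{GSp}_4(F)=\{g\in\mathrm{GL}_4(F):{}^tgJg=\mu(g)J,\ \mu(g)\in F^\times\}$ with $J=\begin{bmatrix}&&&1\\&&1\\&-1\\-1\end{bmatrix}$; $Z$ is its center. Let $K'=G\cap\begin{bmatrix}1+\mathfrak p&\mathfrak o&\mathfrak o&\mathfrak o\\\mathfrak p&1+\mathfrak p&\mathfrak o&\mathfrak o\\\mathfrak p&\mathfrak p&1+\mathfrak p&\mathfrak o\\\mathfrak p&\mathfrak p&\mathfrak p&1+\mathfrak p\end{bmatrix}$ and $H=ZK'$. For $t\in\mathfrak o^\times$, $\chi=\chi_{1,1,t}:H\to\mathbb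 C^\times$ is $\chi(zk)=\psi_0(k_{12}+k_{23}+t\varpi^{-1}k_{41})$ for $z\in Z$, $k\in K'$. Let $g_\chi=\begin{bmatrix}0&0&1&0\\0&0&0&-1\\-\varpi/t&0&0&0\\0&\varpi/t&0&0\end{bmatrix}$, $H'=H\sqcup g_\chi H$, and $\chi^\pm:H'\to\mathbb C^\times$, $\chi^\pm(h)=\chi(h)$, $\chi^\pm(g_\chi h)=\pm\chi(h)$ for $h\in H$. Then $\sigma_\chi^\pm=\text{c-Ind}_{H'}^G(\chi^\pm)$, realized on smooth functions $f:G\to\mathbb C$, compactly supported modulo $Z$, with $f(hg)=\chi^\pm(h)f(g)$ for $h\in H'$, with $G$ acting by right translation. Paramodular group: $K(\mathfrak p^5)=\{k\in G\cap\begin{bmatrix}\mathfrak o&\mathfrak o&\mathfrak o&\mathfrak p^{-5}\\\mathfrak p^5&\mathfrak o&\mathfrak o&\mathfrak o\\\mathfrak p^5&\mathfrak o&\mathfrak o&\mathfrak o\\\mathfrak p^5&\mathfrak p^5&\mathfrak p^5&\mathfrak o\end{bmatrix}:\det k\in\mathfrak o^\times\}$. With $d_{\varpi,\varpi}=\mathrm{diag}(\varpi^3,\varpi^2,\varpi,1)$, the newvector $f^\pm_{\rm new}$ is the function supported on $H'd_{\varpi,\varpi}K(\mathfrak p^5)$ with $f^\pm_{\rm new}(hd_{\varpi,\varpi}k)=\chi^\pm(h)$ for $h\in H'$, $k\in K(\mathfrak p^5)$. The minimal vector $f^\pm_{\rm min}$ is the function equal to $\chi^\pm$ on $H'$ and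 zero outside $H'$. *)

(* Defs.v *)
From HB Require Import structures.
From mathcomp Require Import all_boot all_order all_algebra.
From mathcomp Require Import ring.
From mathcomp Require Import complex.
From mathcomp Require Import all_classical all_reals all_analysis.

Set Implicit Arguments.
Unset Strict Implicit.
Unset Printing Implicit Defensive.

Import Order.TTheory GRing.Theory Num.Theory.

Local Open Scope classical_set_scope.
Local Open Scope ring_scope.

(* A non-archimedean local field of characteristic zero: a field with a
   nontrivial ultrametric absolute value whose topology is locally compact.
   The topology is a separate field, tied to the absolute value by [absv_nbhs],
   so that the library's topology on matrices applies. *)
HB.mixin Record isNALocalField (R : realType) F
    of GRing.Field F & Topological F := {
  absv : F -> R;
  absv_ge0 : forall x, 0 <= absv x;
  absv_eq0 : forall x, (absv x == 0) = (x == 0);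
  absvM : {morph absv : x y / x * y};
  absv_ultra : forall x y, absv (x + y) <= Num.max (absv x) (absv y);
  absv_nontrivial : exists2 x, x != 0 & absv x != 1;
  absv_nbhs : forall (x : F) (A : set F), nbhs x A <->
    exists2 e : R, 0 < e & forall y : F, absv (x - y) < e -> A y;
  field_locally_compact : locally_compact [set: F];
  field_pchar0 : [pchar F] =i pred0 }.

#[short(type="naLocalFieldType")]
HB.structure Definition NALocalField (R : realType) :=
  {F of isNALocalField R F & GRing.Field F & Topological F}.

Section Absv.
Variables (R : realType) (F : naLocalFieldType R).
Implicit Types x y : F.

Definition oring : set F := [set x | absv x <= 1].
Definition ounits : set F := [set x | absv x = 1].
Definition maxideal : set F := [set x | absv x < 1].

Definition uniformizer (varpi : F) : Prop :=
  maxideal = [set varpi * y | y in oring].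

Definition fracideal (varpi : F) (n : int) : set F :=
  [set varpi ^ n * y | y in oring].

(* [s] lists exactly one representative of each class of [S] modulo [I]. *)
Definition representatives (S I : set F) (s : seq F) : Prop :=
  [/\ uniq s, forall a, a \in s -> S a,
      forall x, S x -> exists2 a, a \in s & I (x - a)
    & forall a b, a \in s -> b \in s -> I (a - b) -> a = b].

(* Continuity is automatic for the characters considered below, since they
   are trivial on the open subgroup [oring]. *)
Definition additive_character (psi : F -> R[i]) : Prop :=
  (forall x y, psi (x + y) = psi x * psi y) /\ (forall x, psi x != 0).

Lemma absv0 : absv (0 : F) = 0.
Proof. by apply/eqP; rewrite absv_eq0. Qed.

Lemma absv1 : absv (1 : F) = 1.
Proof.
have := absvM (1 : F) 1; rewrite mulr1 => h.
have n0 : absv (1 : F) != 0 by rewrite absv_eq0 oner_eq0.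
by apply: (mulfI n0); rewrite mulr1.
Qed.

Lemma absvN x : absv (- x) = absv x.
Proof.
apply/eqP; rewrite -(@eqrXn2 _ 2) ?absv_ge0//.
by rewrite !expr2 -!absvM mulrNN.
Qed.

Lemma absvV x : absv x^-1 = (absv x)^-1.
Proof.
have [->|x0] := eqVneq x 0; first by rewrite invr0 absv0 invr0.
have n0 : absv x != 0 by rewrite absv_eq0.
by apply: (mulfI n0); rewrite -absvM !mulfV// absv1.
Qed.

Lemma absvD_le x y (r : R) : absv x <= r -> absv y <= r -> absv (x + y) <= r.
Proof.
by move=> xr yr; rewrite (le_trans (absv_ultra x y))// ge_max xr yr.
Qed.

Lemma absvD_lt x y (r : R) : absv x < r -> absv y < r -> absv (x + y) < r.
Proof.
by move=> xr yr; rewrite (le_lt_trans (absv_ultra x y))// gt_max xr yr.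
Qed.

Lemma absvM_lt1 x y : absv x < 1 -> absv y <= 1 -> absv (x * y) < 1.
Proof.
move=> x1 y1; rewrite absvM; apply: le_lt_trans x1.
by apply: ler_piMr => //; exact: absv_ge0.
Qed.

Lemma absv_1Dmax x : absv (x - 1) < 1 -> absv x = 1.
Proof.
move=> x1; apply/eqP; rewrite eq_le; apply/andP; split.
  by rewrite -[x](subrK 1) absvD_le ?absv1// ltW.
rewrite leNgt; apply/negP => xl.
have : absv (x - (x - 1)) < 1 by rewrite absvD_lt ?absvN.
by rewrite opprB addrCA subrr addr0 absv1 ltxx.
Qed.

Lemma uniformizer_neq0 varpi : uniformizer varpi -> varpi != 0.
Proof.
move=> pE; apply/eqP => p0.
have small0 x : absv x < 1 -> x = 0.
  by move=> x1; have : maxideal x by []; rewrite pE => -[y _ <-]; rewrite p0 mul0r.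
have [x x0 x1] := absv_nontrivial (s := F).
have [xl|xg] := ltP (absv x) 1; first by rewrite (small0 x xl) eqxx in x0.
have xgt : 1 < absv x by rewrite lt_neqAle eq_sym x1.
have /small0/eqP : absv x^-1 < 1 by rewrite absvV invf_lt1// (lt_trans _ xgt).
by rewrite invr_eq0 (negPf x0).
Qed.

Lemma maxideal_div varpi x :
  uniformizer varpi -> absv x < 1 -> absv (varpi^-1 * x) <= 1.
Proof.
move=> pE x1; have : maxideal x by []; rewrite pE => -[y y1 <-].
by rewrite mulrA mulVf ?uniformizer_neq0// mul1r.
Qed.

Lemma absv_uniformizer varpi : uniformizer varpi -> absv varpi < 1.
Proof.
move=> pE; suff : maxideal varpi by [].
by rewrite pE; exists 1; [rewrite /oring/= absv1|rewrite mulr1].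
Qed.

Lemma natf_neq0 (n : nat) : n.+1%:R != 0 :> F.
Proof. by rewrite ((pcharf0P F).1 field_pchar0). Qed.

End Absv.

Definition mx4 (F : fieldType) (s : seq (seq F)) : 'M[F]_4 :=
  \matrix_(i, j) (nth [::] s i)`_j.

Ltac mx4_tac :=
  apply/matrixP => -[[|[|[|[|//]]]] ?] -[[|[|[|[|//]]]] ?];
  rewrite !(mxE, big_ord_recl, big_ord0) /=.

Section Mx4.
Variable F : fieldType.

Lemma mx4M
    (a00 a01 a02 a03 a10 a11 a12 a13
    a20 a21 a22 a23 a30 a31 a32 a33
    b00 b01 b02 b03 b10 b11 b12 b13
    b20 b21 b22 b23 b30 b31 b32 b33 : F) :
  mx4 [:: [:: a00; a01; a02; a03];
       [:: a10; a11; a12; a13];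
       [:: a20; a21; a22; a23];
       [:: a30; a31; a32; a33]] *m
  mx4 [:: [:: b00; b01; b02; b03];
       [:: b10; b11; b12; b13];
       [:: b20; b21; b22; b23];
       [:: b30; b31; b32; b33]] =
  mx4 [:: [:: a00 * b00 + a01 * b10 + a02 * b20 + a03 * b30;
             a00 * b01 + a01 * b11 + a02 * b21 + a03 * b31;
             a00 * b02 + a01 * b12 + a02 * b22 + a03 * b32;
             a00 * b03 + a01 * b13 + a02 * b23 + a03 * b33];
         [:: a10 * b00 + a11 * b10 + a12 * b20 + a13 * b30;
             a10 * b01 + a11 * b11 + a12 * b21 + a13 * b31;
             a10 * b02 + a11 * b12 + a12 * b22 + a13 * b32;
             a10 * b03 + a11 * b13 + a12 * b23 + a13 * b33];
         [:: a20 * b00 + a21 * b10 + a22 * b20 + a23 * b30;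
             a20 * b01 + a21 * b11 + a22 * b21 + a23 * b31;
             a20 * b02 + a21 * b12 + a22 * b22 + a23 * b32;
             a20 * b03 + a21 * b13 + a22 * b23 + a23 * b33];
         [:: a30 * b00 + a31 * b10 + a32 * b20 + a33 * b30;
             a30 * b01 + a31 * b11 + a32 * b21 + a33 * b31;
             a30 * b02 + a31 * b12 + a32 * b22 + a33 * b32;
             a30 * b03 + a31 * b13 + a32 * b23 + a33 * b33]].
Proof. by mx4_tac; rewrite addr0 ?addrA. Qed.

Lemma mx4T
    (a00 a01 a02 a03 a10 a11 a12 a13 a20 a21 a22 a23 a30 a31 a32 a33 : F) :
  (mx4 [:: [:: a00; a01; a02; a03];
        [:: a10; a11; a12; a13];
        [:: a20; a21; a22; a23];
        [:: a30; a31; a32; a33]])^T =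
  mx4 [:: [:: a00; a10; a20; a30];
       [:: a01; a11; a21; a31];
       [:: a02; a12; a22; a32];
       [:: a03; a13; a23; a33]].
Proof. by mx4_tac. Qed.

Lemma mx4Z
    (c a00 a01 a02 a03 a10 a11 a12 a13 a20 a21 a22 a23 a30 a31 a32 a33 : F) :
  c *: mx4 [:: [:: a00; a01; a02; a03];
            [:: a10; a11; a12; a13];
            [:: a20; a21; a22; a23];
            [:: a30; a31; a32; a33]] =
  mx4 [:: [:: c * a00; c * a01; c * a02; c * a03];
       [:: c * a10; c * a11; c * a12; c * a13];
       [:: c * a20; c * a21; c * a22; c * a23];
       [:: c * a30; c * a31; c * a32; c * a33]].
Proof. by mx4_tac. Qed.

Lemma mx4_inj (s1 s2 : seq (seq F)) (i j : 'I_4) :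
  mx4 s1 = mx4 s2 -> (nth [::] s1 i)`_j = (nth [::] s2 i)`_j.
Proof. by move=> /matrixP/(_ i j); rewrite !mxE. Qed.

Lemma mx4_eta (A : 'M[F]_4) :
  A = mx4 [:: [:: A 0 0; A 0 1; A 0 2; A 0 3]; [:: A 1 0; A 1 1; A 1 2; A 1 3];
              [:: A 2 0; A 2 1; A 2 2; A 2 3]; [:: A 3 0; A 3 1; A 3 2; A 3 3]].
Proof. by mx4_tac; congr (A _ _); exact: val_inj. Qed.

End Mx4.

Definition Jmx {F : fieldType} : 'M[F]_4 := mx4 [:: [:: 0; 0; 0; 1];
                                    [:: 0; 0; 1; 0];
                                    [:: 0; -1; 0; 0];
                                    [:: -1; 0; 0; 0]].

Ltac mx4_eq :=
  congr (mx4 [:: [:: _; _; _; _]; [:: _; _; _; _]; [:: _; _; _; _];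
                 [:: _; _; _; _]]).

Ltac gsp4 := rewrite /Jmx mx4T !mx4M mx4Z; mx4_eq.

Section GSp4.
Variable F : fieldType.

Definition is_GSp4 : pred 'M[F]_4 := fun g =>
  `[< g \in unitmx /\ exists2 mu : F, mu != 0 & g^T *m Jmx *m g = mu *: Jmx >].

Record GSp4 := MkGSp4 { GSp4_mx :> 'M[F]_4; _ : is_GSp4 GSp4_mx }.

HB.instance Definition _ := [isSub for GSp4_mx].
HB.instance Definition _ := [Choice of GSp4 by <:].

Lemma Jmx2 : Jmx *m Jmx = (-1)%:M :> 'M[F]_4.
Proof. by mx4_tac; ring. Qed.

Lemma is_GSp4I (g : 'M[F]_4) (mu : F) :
  mu != 0 -> g^T *m Jmx *m g = mu *: Jmx -> is_GSp4 g.
Proof.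
move=> mu0 gJ; apply/asboolP; split; last by exists mu.
have : (- mu^-1) *: (Jmx *m g^T *m Jmx) *m g = 1%:M.
  rewrite -scalemxAl -!mulmxA [_ *m (_ *m g)]mulmxA gJ -scalemxAr Jmx2.
  by rewrite scalerA scale_scalar_mx mulNr mulVf// mulrNN mulr1.
by case/mulmx1_unit.
Qed.

Lemma is_GSp4E (g : 'M[F]_4) : is_GSp4 g ->
  g \in unitmx /\ exists2 mu : F, mu != 0 & g^T *m Jmx *m g = mu *: Jmx.
Proof. by move/asboolP. Qed.

Lemma is_GSp4_1 : is_GSp4 1%:M.
Proof.
by apply: (@is_GSp4I _ 1); rewrite ?oner_eq0// trmx1 mul1mx mulmx1 scale1r.
Qed.

Lemma is_GSp4M (g h : 'M[F]_4) : is_GSp4 g -> is_GSp4 h -> is_GSp4 (g *m h).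
Proof.
move=> /is_GSp4E[_ [a a0 ga]] /is_GSp4E[_ [b b0 hb]].
apply: (@is_GSp4I _ (a * b)); first by rewrite mulf_neq0.
have -> : (g *m h)^T *m Jmx *m (g *m h) = h^T *m (g^T *m Jmx *m g) *m h.
  by rewrite trmx_mul !mulmxA.
by rewrite ga -scalemxAr -scalemxAl hb scalerA.
Qed.

Lemma is_GSp4V (g : 'M[F]_4) : is_GSp4 g -> is_GSp4 (invmx g).
Proof.
move=> /is_GSp4E[gu [a a0 ga]].
apply: (@is_GSp4I _ a^-1); first by rewrite invr_eq0.
have -> : (invmx g)^T *m Jmx *m invmx g =
    a^-1 *: ((invmx g)^T *m (a *: Jmx) *m invmx g).
  by rewrite -scalemxAr -scalemxAl scalerA mulVf// scale1r.
rewrite -ga; congr (_ *: _).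
rewrite trmx_inv !mulmxA mulVmx ?unitmx_tr// mul1mx -mulmxA mulmxV//.
by rewrite mulmx1.
Qed.

Definition GSp4_one : GSp4 := MkGSp4 is_GSp4_1.
Definition GSp4_mul (g h : GSp4) : GSp4 := MkGSp4 (is_GSp4M (valP g) (valP h)).
Definition GSp4_inv (g : GSp4) : GSp4 := MkGSp4 (is_GSp4V (valP g)).

Lemma GSp4_mulA : associative GSp4_mul.
Proof. by move=> g h k; apply: val_inj; rewrite /= mulmxA. Qed.
Lemma GSp4_mul1g : left_id GSp4_one GSp4_mul.
Proof. by move=> g; apply: val_inj; rewrite /= mul1mx. Qed.
Lemma GSp4_mulg1 : right_id GSp4_one GSp4_mul.
Proof. by move=> g; apply: val_inj; rewrite /= mulmx1. Qed.
Lemma GSp4_mulVg : left_inverse GSp4_one GSp4_inv GSp4_mul.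
Proof.
move=> g; apply: val_inj; rewrite /= mulVmx//.
by case: (is_GSp4E (valP g)).
Qed.
Lemma GSp4_mulgV : right_inverse GSp4_one GSp4_inv GSp4_mul.
Proof.
move=> g; apply: val_inj; rewrite /= mulmxV//.
by case: (is_GSp4E (valP g)).
Qed.

HB.instance Definition _ := isGroup.Build GSp4
  GSp4_mulA GSp4_mul1g GSp4_mulg1 GSp4_mulVg GSp4_mulgV.

(* The default value is never used: every matrix to which [toGSp4] is applied
   below is in GSp4, and [toGSp4K] then gives its value. *)
Definition toGSp4 (g : 'M[F]_4) : GSp4 := insubd (1%g : GSp4) g.

Lemma toGSp4K (g : 'M[F]_4) : is_GSp4 g -> toGSp4 g = g :> 'M[F]_4.
Proof. by move=> gG; rewrite /toGSp4 (insubdK _ gG). Qed.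

Lemma GSp4_mulE (g h : GSp4) : (g * h)%g = g *m h :> 'M[F]_4.
Proof. by []. Qed.

Definition centerG : set GSp4 := [set z | forall g, (z * g = g * z)%g].

End GSp4.

Arguments centerG {F}.

Section Representation.
Variables (R : realType) (F : naLocalFieldType R).
Local Notation G := (GSp4 F).

HB.instance Definition _ :=
  Topological.copy G (initial_topology (@GSp4_mx F)).

Lemma GSp4_mx_continuous : continuous (fun g : G => g : 'M[F]_4).
Proof. exact: initial_continuous. Qed.

Lemma rmul_continuous (g : G) : continuous (fun x : G => (x * g)%g).
Proof.
apply: continuous_comp_initial => x.
apply: (@continuous_comp G _ _ (@GSp4_mx F) (fun A => A *m g)).
  exact: GSp4_mx_continuous.
move: (x : 'M[F]_4) => A; move: (g : 'M[F]_4) => {x g} B.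
move=> U [P nP sPU].
have coord (S : set F) i k : nbhs (A i k) S -> nbhs A [set X : 'M[F]_4 | S (X i k)].
  move=> nS; exists (fun i' k' => if (i' == i) && (k' == k) then S else setT).
    by move=> i' k'; case: ifP => [/andP[/eqP-> /eqP->]//|_]; exact: filterT.
  by move=> X /(_ i k); rewrite !eqxx.
have nA i j : nbhs A [set X : 'M[F]_4 | P i j ((X *m B) i j)].
  have /absv_nbhs[e e0 eP] := nP i j.
  have nk k : nbhs A [set X : 'M[F]_4 | absv ((A i k - X i k) * B k j) < e].
    apply: (coord [set y | absv ((A i k - y) * B k j) < e]).
    have b0 : 0 < absv (B k j) + 1 by rewrite ltr_wpDl ?absv_ge0.
    apply/absv_nbhs; exists (e / (absv (B k j) + 1)); first by rewrite divr_gt0.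
    move=> y; rewrite ltr_pdivlMr// /= absvM; apply: le_lt_trans.
    by rewrite ler_wpM2l ?absv_ge0// lerDl.
  have nkA : nbhs A
      [set X : 'M[F]_4 | forall k, absv ((A i k - X i k) * B k j) < e].
    exact: (@filter_forall _ _
      (fun k (X : 'M[F]_4) => absv ((A i k - X i k) * B k j) < e) (nbhs A)).
  apply: filterS nkA => X Xe; apply: eP; rewrite !mxE -sumrB.
  elim/big_ind : _ => [|x y|k _]; first by rewrite absv0.
    exact: absvD_lt.
  by rewrite -mulrBl; exact: Xe.
have nAA : nbhs A [set X : 'M[F]_4 | forall i j, P i j ((X *m B) i j)].
  apply: (@filter_forall _ _
    (fun i (X : 'M[F]_4) => forall j, P i j ((X *m B) i j)) (nbhs A)) => i.
  exact: (@filter_forall _ _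
    (fun j (X : 'M[F]_4) => P i j ((X *m B) i j)) (nbhs A) _ (nA i)).
by apply: filterS nAA => X Xe; exact: sPU.
Qed.

(* Compact induction from [H] of [chi], whose values off [H] are irrelevant.
   "Smooth" means locally constant. *)
Definition is_cInd (H : set G) (chi : G -> R[i]) (f : G -> R[i]) : Prop :=
  [/\ forall h g, H h -> f (h * g)%g = chi h * f g,
      forall g, \forall x \near g, f x = f g
    & exists2 Om : set G, compact Om &
        forall g, f g != 0 -> exists z w, [/\ centerG z, Om w & g = (z * w)%g]].

Variables (H : set G) (chi : G -> R[i]).

Definition cInd_pred : {pred G -> R[i]} := fun f => `[< is_cInd H chi f >].

Lemma cInd_submod_closed : submod_closed cInd_pred.
Proof.
split=> [|a f1 f2 /asboolP[e1 s1 [D1 c1 z1]] /asboolP[e2 s2 [D2 c2 z2]]];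
    apply/asboolP; split.
- by move=> h g _; rewrite mulr0.
- by move=> g; near=> x.
- by exists set0 => [|g]; [exact: compact0|rewrite eqxx].
- move=> h g Hh; rewrite /= !fctE e1// e2// mulrDr; congr (_ + _).
  by rewrite mulrCA.
- by move=> g; apply: filterS2 (s1 g) (s2 g) => x; rewrite !fctE => -> ->.
- exists (D1 `|` D2); first exact: compactU.
  move=> g; rewrite !fctE; have [-> |n1 _] := eqVneq (f1 g) 0.
    rewrite scaler0 add0r => /z2[z [w [? ? ->]]].
    by exists z, w; split => //; right.
  by have [z [w [? ? ->]]] := z1 g n1; exists z, w; split => //; left.
Unshelve. all: by end_near. Qed.

HB.instance Definition _ :=
  GRing.isSubmodClosed.Build _ _ cInd_pred cInd_submod_closed.

Record cInd := MkcInd { cInd_fun :> G -> R[i]; _ : cInd_fun \in cInd_pred }.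

HB.instance Definition _ := [isSub for cInd_fun].
HB.instance Definition _ := [Choice of cInd by <:].
HB.instance Definition _ := [SubChoice_isSubLmodule of cInd by <:].

Lemma rtransl_subproof (g : G) (f : cInd) :
  (fun x : G => f (x * g)%g) \in cInd_pred.
Proof.
have /asboolP[e s [D c z]] := valP f; apply/asboolP; split.
- by move=> h x Hh; rewrite -mulgA e.
- by move=> x; exact: (rmul_continuous (s (x * g)%g)).
- exists ((fun x : G => (x * g^-1)%g) @` D).
    apply: continuous_compact => //; apply: continuous_subspaceT.
    exact: rmul_continuous.
  move=> x /z[a [w [Za Ow xgE]]]; exists a, (w * g^-1)%g; split => //.
    by exists w.
  by rewrite mulgA -xgE mulgK.
Qed.

Definition rtransl (g : G) (f : cInd) : cInd := MkcInd (rtransl_subproof g f).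

End Representation.

Section Elements.
Variable F : fieldType.
Implicit Types (u v x y varpi t : F).

Definition torus u v : GSp4 F := toGSp4 (mx4 [:: [:: u * v; 0; 0; 0];
                                                 [:: 0; u; 0; 0];
                                                 [:: 0; 0; v; 0];
                                                 [:: 0; 0; 0; 1]]).

Definition delta varpi : GSp4 F := toGSp4 (mx4 [:: [:: 1; 0; 0; 0];
                                                   [:: 0; varpi; 0; 0];
                                                   [:: 0; 0; varpi ^+ 2; 0];
                                                   [:: 0; 0; 0; varpi ^+ 3]]).

Definition dvarpi varpi : GSp4 F := toGSp4 (mx4 [:: [:: varpi ^+ 3; 0; 0; 0];
                                                    [:: 0; varpi ^+ 2; 0; 0];
                                                    [:: 0; 0; varpi; 0];
                                                    [:: 0; 0; 0; 1]]).

Definition ell x : GSp4 F := toGSp4 (mx4 [:: [:: 1; 0; 0; 0];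
                                             [:: 0; 1; 0; 0];
                                             [:: 0; x; 1; 0];
                                             [:: 0; 0; 0; 1]]).

Definition unip y : GSp4 F := toGSp4 (mx4 [:: [:: 1; 0; 0; y];
                                              [:: 0; 1; 0; 0];
                                              [:: 0; 0; 1; 0];
                                              [:: 0; 0; 0; 1]]).

Definition w1 : GSp4 F := toGSp4 (mx4 [:: [:: 1; 0; 0; 0];
                                          [:: 0; 0; -1; 0];
                                          [:: 0; 1; 0; 0];
                                          [:: 0; 0; 0; 1]]).

Definition w2 varpi : GSp4 F := toGSp4 (mx4 [:: [:: 0; 0; 0; - varpi ^- 5];
                                                [:: 0; 0; -1; 0];
                                                [:: 0; 1; 0; 0];
                                                [:: varpi ^+ 5; 0; 0; 0]]).

Definition w3 varpi : GSp4 F := toGSp4 (mx4 [:: [:: 0; 0; 0; - varpi ^- 5];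
                                                [:: 0; 1; 0; 0];
                                                [:: 0; 0; 1; 0];
                                                [:: varpi ^+ 5; 0; 0; 0]]).

Definition gchi varpi t : GSp4 F := toGSp4 (mx4 [:: [:: 0; 0; 1; 0];
                                                    [:: 0; 0; 0; -1];
                                                    [:: - (varpi / t); 0; 0; 0];
                                                    [:: 0; varpi / t; 0; 0]]).

Lemma torusE u v : u != 0 -> v != 0 -> torus u v =
  mx4 [:: [:: u * v; 0; 0; 0]; [:: 0; u; 0; 0]; [:: 0; 0; v; 0]; [:: 0; 0; 0; 1]]
  :> 'M[F]_4.
Proof.
by move=> u0 v0; apply/toGSp4K/(@is_GSp4I _ _ (u * v));
  [rewrite mulf_neq0|gsp4; ring].
Qed.

Lemma deltaE varpi : varpi != 0 -> delta varpi =
  mx4 [:: [:: 1; 0; 0; 0]; [:: 0; varpi; 0; 0]; [:: 0; 0; varpi ^+ 2; 0];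
          [:: 0; 0; 0; varpi ^+ 3]] :> 'M[F]_4.
Proof.
by move=> p0; apply/toGSp4K/(@is_GSp4I _ _ (varpi ^+ 3));
  [rewrite expf_neq0|gsp4; ring].
Qed.

Lemma dvarpiE varpi : varpi != 0 -> dvarpi varpi =
  mx4 [:: [:: varpi ^+ 3; 0; 0; 0]; [:: 0; varpi ^+ 2; 0; 0];
          [:: 0; 0; varpi; 0]; [:: 0; 0; 0; 1]] :> 'M[F]_4.
Proof.
by move=> p0; apply/toGSp4K/(@is_GSp4I _ _ (varpi ^+ 3));
  [rewrite expf_neq0|gsp4; ring].
Qed.

Lemma ellE x : ell x =
  mx4 [:: [:: 1; 0; 0; 0]; [:: 0; 1; 0; 0]; [:: 0; x; 1; 0]; [:: 0; 0; 0; 1]]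
  :> 'M[F]_4.
Proof.
by apply/toGSp4K/(@is_GSp4I _ _ 1); [rewrite oner_neq0|gsp4; ring].
Qed.

Lemma unipE y : unip y =
  mx4 [:: [:: 1; 0; 0; y]; [:: 0; 1; 0; 0]; [:: 0; 0; 1; 0]; [:: 0; 0; 0; 1]]
  :> 'M[F]_4.
Proof.
by apply/toGSp4K/(@is_GSp4I _ _ 1); [rewrite oner_neq0|gsp4; ring].
Qed.

Lemma w1E : w1 =
  mx4 [:: [:: 1; 0; 0; 0]; [:: 0; 0; -1; 0]; [:: 0; 1; 0; 0]; [:: 0; 0; 0; 1]]
  :> 'M[F]_4.
Proof.
by apply/toGSp4K/(@is_GSp4I _ _ 1); [rewrite oner_neq0|gsp4; ring].
Qed.

Lemma w2E varpi : varpi != 0 -> w2 varpi =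
  mx4 [:: [:: 0; 0; 0; - varpi ^- 5]; [:: 0; 0; -1; 0]; [:: 0; 1; 0; 0];
          [:: varpi ^+ 5; 0; 0; 0]] :> 'M[F]_4.
Proof.
move=> p0; apply/toGSp4K/(@is_GSp4I _ _ 1); first by rewrite oner_neq0.
by gsp4; field.
Qed.

Lemma w3E varpi : varpi != 0 -> w3 varpi =
  mx4 [:: [:: 0; 0; 0; - varpi ^- 5]; [:: 0; 1; 0; 0]; [:: 0; 0; 1; 0];
          [:: varpi ^+ 5; 0; 0; 0]] :> 'M[F]_4.
Proof.
move=> p0; apply/toGSp4K/(@is_GSp4I _ _ 1); first by rewrite oner_neq0.
by gsp4; field.
Qed.

Lemma gchiE varpi t : varpi != 0 -> t != 0 -> gchi varpi t =
  mx4 [:: [:: 0; 0; 1; 0]; [:: 0; 0; 0; -1]; [:: - (varpi / t); 0; 0; 0];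
          [:: 0; varpi / t; 0; 0]] :> 'M[F]_4.
Proof.
move=> p0 t0; apply/toGSp4K/(@is_GSp4I _ _ (- (varpi / t))).
  by rewrite oppr_eq0 mulf_neq0 ?invr_eq0.
by gsp4; field.
Qed.

End Elements.

Section Characters.
Variables (R : realType) (F : naLocalFieldType R).
Local Notation G := (GSp4 F).

Lemma natf_eq (m n : nat) : (m%:R == n%:R :> F) = (m == n).
Proof.
wlog mn : m n / (m <= n)%N.
  by move=> w; have [/w//|/ltnW/w] := leqP m n; rewrite eq_sym => ->.
rewrite eq_sym -subr_eq0 -natrB// ((pcharf0P F).1 field_pchar0).
by rewrite subn_eq0 eqn_leq mn.
Qed.

Let mulIC0 (x : F) (m n : nat) : x * m%:R = n%:R * x -> m != n -> x = 0.
Proof.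
move=> /[swap] mn /eqP; rewrite mulrC -subr_eq0 -mulrBl mulf_eq0 subr_eq0 natf_eq.
by rewrite (negPf mn) => /eqP.
Qed.

Let mulI10 (x : F) (n : nat) : x = n%:R * x -> 1%N != n -> x = 0.
Proof. by move=> xn n1; apply: (@mulIC0 x 1%N n _ n1); rewrite mulr1. Qed.

Let mulI01 (x : F) (n : nat) : x * n%:R = x -> n != 1%N -> x = 0.
Proof. by move=> xn n1; apply: (@mulIC0 x n 1%N _ n1); rewrite mul1r. Qed.

Lemma centerG_scalar (z : G) :
  centerG z -> exists2 c : F, c != 0 & z = c%:M :> 'M[F]_4.
Proof.
move=> zC; have zC' (g : G) : z *m g = g *m z :> 'M[F]_4.
  by have := zC g => /(congr1 (@GSp4_mx F)).
pose S : 'M[F]_4 := mx4 [:: [:: 1; 1; 0; 0]; [:: 0; 1; 0; 0]; [:: 0; 0; 1; -1];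
                            [:: 0; 0; 0; 1]].
have SG : is_GSp4 S.
  by apply: (@is_GSp4I _ _ 1); [rewrite oner_neq0|rewrite /S; gsp4; ring].
have := zC' (toGSp4 S); rewrite toGSp4K// /S.
have := zC' (torus 2%:R 3%:R); rewrite torusE ?natf_neq0//.
have := zC' (unip 1); rewrite unipE; have := zC' (w1 F); rewrite w1E.
have : (z : 'M[F]_4) \in unitmx by case: (is_GSp4E (valP z)).
rewrite (mx4_eta z); set a := (z : 'M[F]_4); rewrite !mx4M -natrM.
rewrite !(mulr0, mul0r, addr0, add0r, mulr1, mul1r, mulrN1, mulN1r).
move=> zu Ew En Et Es.
have /= /mulIC0/(_ isT) a01 := mx4_inj 0 1 Et.
have /= /mulIC0/(_ isT) a02 := mx4_inj 0 2 Et.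
have /= /mulI10/(_ isT) a03 := mx4_inj 0 3 Et.
have /= /mulIC0/(_ isT) a10 := mx4_inj 1 0 Et.
have /= /mulIC0/(_ isT) a12 := mx4_inj 1 2 Et.
have /= /mulI10/(_ isT) a13 := mx4_inj 1 3 Et.
have /= /mulIC0/(_ isT) a20 := mx4_inj 2 0 Et.
have /= /mulIC0/(_ isT) a21 := mx4_inj 2 1 Et.
have /= /mulI10/(_ isT) a23 := mx4_inj 2 3 Et.
have /= /mulI01/(_ isT) a30 := mx4_inj 3 0 Et.
have /= /mulI01/(_ isT) a31 := mx4_inj 3 1 Et.
have /= /mulI01/(_ isT) a32 := mx4_inj 3 2 Et.
have /= a03' := mx4_inj 0 3 En; rewrite a03 addr0 add0r in a03'.
have /= /oppr_inj a12' := mx4_inj 1 2 Ew.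
have /= a01' := mx4_inj 0 1 Es; rewrite a01 addr0 add0r in a01'.
have zE : mx4 [:: [:: a 0 0; a 0 1; a 0 2; a 0 3];
                  [:: a 1 0; a 1 1; a 1 2; a 1 3];
                  [:: a 2 0; a 2 1; a 2 2; a 2 3];
                  [:: a 3 0; a 3 1; a 3 2; a 3 3]] = (a 0 0)%:M.
  rewrite a01 a02 a03 a10 a12 a13 a20 a21 a23 a30 a31 a32.
  rewrite -a12' -a01' -a03'.
  by mx4_tac; rewrite ?mulr1n ?mulr0n.
exists (a 0 0) => //; apply: contraTneq zu => a0.
by rewrite zE a0 unitmxE det_scalar expr0n unitr0.
Qed.

Variables (varpi : F) (psi : F -> R[i]) (t : F).

Definition psi0 (x : F) : R[i] := psi (varpi^-1 * x).

Definition Kprime : set G := [set k : G |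
  forall i j : 'I_4, if i == j then maxideal (k i j - 1)
                     else if (i < j)%N then oring (k i j) else maxideal (k i j)].

Definition Hgrp : set G := [set (z * k)%g | z in centerG & k in Kprime].

(* The argument of psi0 in the definition of chi; rows and columns are numbered
   from 0. *)
Definition chi_arg (k : G) : F := k 0 1 + k 1 2 + t * varpi^-1 * k 3 0.

(* chi (z k) = psi0 (chi_arg k) for z in Z and k in K', see [chiE]; values off
   [Hgrp] are irrelevant. *)
Definition chi (h : G) : R[i] :=
  psi0 (chi_arg (xget (1%g, 1%g) [set zk : G * G |
    [/\ centerG zk.1, Kprime zk.2 & h = (zk.1 * zk.2)%g]]).2).

Definition Hgrp' : set G := Hgrp `|` [set (gchi varpi t * h)%g | h in Hgrp].

(* chi^+ for [e = false] and chi^- for [e = true]; see [chipm_H] and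
   [chipm_gH]. Values off [Hgrp'] are irrelevant. *)
Definition chipm (e : bool) (h : G) : R[i] :=
  if `[< Hgrp h >] then chi h else (-1) ^+ e * chi ((gchi varpi t)^-1 * h)%g.

Hypothesis varpi_unif : uniformizer varpi.
Hypothesis psi_char : additive_character psi.
Hypothesis psi_oring : forall x, oring x -> psi x = 1.
Hypothesis t_unit : ounits t.

Lemma chiE (z k : G) :
  centerG z -> Kprime k -> chi (z * k)%g = psi0 (chi_arg k).
Proof.
move=> zC kK; rewrite /chi.
have ex : exists zk : G * G,
    [/\ centerG zk.1, Kprime zk.2 & (z * k)%g = (zk.1 * zk.2)%g].
  by exists (z, k).
have /= := xgetPex (1%g, 1%g) ex.
case: (xget _ _) => z' k' /= [zC' kK' /(congr1 (@GSp4_mx F))/= zkE].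
have [c c0 zc] := centerG_scalar zC; have [c' c'0 zc'] := centerG_scalar zC'.
have kE (i j : 'I_4) : k' i j = c / c' * k i j.
  move: zkE => /matrixP/(_ i j); rewrite zc zc' !mul_scalar_mx !mxE => E.
  by apply: (mulfI c'0); rewrite -E; field.
move: (c / c') kE => d kE.
have := kK 0 0; have := kK' 0 0; rewrite /= kE => dk1 k1.
have k00 := absv_1Dmax k1.
have d1 : absv (d - 1) < 1.
  have : absv ((d - 1) * k 0 0) < 1.
    have -> : (d - 1) * k 0 0 = (d * k 0 0 - 1) + - (k 0 0 - 1) by ring.
    by rewrite absvD_lt ?absvN.
  by rewrite absvM k00 mulr1.
have pk : absv (chi_arg k) <= 1.
  have := kK 0 1; have := kK 1 2; have := kK 3 0 => /= k30 k12 k01.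
  rewrite /chi_arg; apply: absvD_le; first exact: absvD_le.
  by rewrite -mulrA absvM t_unit mul1r; exact: maxideal_div.
have -> : chi_arg k' = chi_arg k + (d - 1) * chi_arg k.
  by rewrite /chi_arg !kE; ring.
rewrite /psi0 mulrDr psi_char.1 [X in _ * X]psi_oring ?mulr1//.
by apply: maxideal_div => //; exact: absvM_lt1.
Qed.

Lemma chipm_H (e : bool) (h : G) : Hgrp h -> chipm e h = chi h.
Proof. by rewrite /chipm => /asboolT ->. Qed.

Lemma chipm_gH (e : bool) (h : G) :
  Hgrp h -> chipm e (gchi varpi t * h)%g = (-1) ^+ e * chi h.
Proof.
move=> hH; rewrite /chipm mulKg; case: ifPn => // /asboolP.
have p0 := uniformizer_neq0 varpi_unif.
have t0 : t != 0 by rewrite -absv_eq0 t_unit oner_eq0.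
case: hH => z zC [k kK <-] [z' zC' [k' kK']] /(congr1 (@GSp4_mx F))/=.
have [c c0 ->] := centerG_scalar zC; have [c' c'0 ->] := centerG_scalar zC'.
rewrite gchiE// (mx4_eta k) (mx4_eta k') !mul_scalar_mx !mx4Z mx4M.
have := kK 0 0; have := kK 2 0; have := kK' 0 0; have := kK' 2 0 => /=.
move=> k'20 /absv_1Dmax k'00 k20 /absv_1Dmax k00 E.
have /= /(congr1 absv) := mx4_inj 0 0 E; have /= /(congr1 absv) := mx4_inj 2 0 E.
rewrite !(mul0r, add0r, addr0, mul1r) !absvM absvN absvM absvV t_unit k00 k'00.
rewrite invr1 !mulr1 => E2 E0.
have c'p : 0 < absv c' by rewrite lt_neqAle absv_ge0 eq_sym absv_eq0 c'0.
have cp : 0 < absv c by rewrite lt_neqAle absv_ge0 eq_sym absv_eq0 c0.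
have pp : 0 < absv varpi by rewrite lt_neqAle absv_ge0 eq_sym absv_eq0 p0.
have c'c : absv c' < absv c by rewrite E0 gtr_pMr.
have := maxideal_div varpi_unif k'20; rewrite absvM absvV ler_pdivrMl// mulr1.
move=> k'p; have : absv c' * absv (k' 2 0) <= absv c' * absv varpi.
  by rewrite ler_wpM2l// ltW.
by rewrite E2 mulrC ler_pM2r// leNgt c'c.
Qed.

End Characters.

Section Vectors.
Variables (R : realType) (F : naLocalFieldType R).
Variables (varpi : F) (psi : F -> R[i]) (t : F) (e : bool).
Local Notation G := (GSp4 F).

(* The paramodular group of level p^n. *)
Definition paramodular_exp (n : int) (i j : nat) : int :=
  nth 0 (nth [::] [:: [:: 0; 0; 0; - n];
                      [:: n; 0; 0; 0];
                      [:: n; 0; 0; 0];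
                      [:: n; n; n; 0]] i) j.

Definition paramodular (n : int) : set G := [set k : G |
  (forall i j : 'I_4, fracideal varpi (paramodular_exp n i j) (k i j))
  /\ ounits (\det (k : 'M[F]_4))].

Definition sigma_chi := cInd (Hgrp' varpi t) (chipm varpi psi t e).

Definition is_newvector (f : sigma_chi) : Prop :=
  (forall h k, Hgrp' varpi t h -> paramodular 5 k ->
     f (h * dvarpi varpi * k)%g = chipm varpi psi t e h) /\
  (forall g, (forall h k, Hgrp' varpi t h -> paramodular 5 k ->
     g <> (h * dvarpi varpi * k)%g) -> f g = 0).

Definition is_minimal_vector (f : sigma_chi) : Prop :=
  (forall h, Hgrp' varpi t h -> f h = chipm varpi psi t e h) /\
  (forall g, ~ Hgrp' varpi t g -> f g = 0).

End Vectors.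

(* Main.v *)
(* Modulo the center, [delta] is the inverse of d = [dvarpi]. A term of the sum
   indexed by g in K(p^5) is therefore fmin (x g d^-1), which equals fnew x when
   x g d^-1 is in H' and 0 otherwise, so all that is needed is that the elements
   g represent the cosets of K(p^5) modulo L, its intersection with d^-1 H' d.
   The similitude factor shows that only H contributes to L, and that L is cut
   out by k21 in p^2, k03 in p^-3 and the diagonal entries being congruent mod p.
   The first two conditions on k g say that the two blocks of g pick out given
   points of the projective line over o/p^2, whence the four cells; the last one
   then determines the torus part (u, v) uniquely. *)

Require Import Defs.
From mathcomp Require Import all_boot all_order all_algebra.
From mathcomp Require Import ring.
From mathcomp Require Import complex.
From mathcomp Require Import all_classical all_reals all_analysis.

Set Implicit Arguments.
Unset Strict Implicit.
Unset Printing Implicit Defensive.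

Import Order.TTheory GRing.Theory Num.Theory.

Local Open Scope classical_set_scope.
Local Open Scope ring_scope.

(** * Fourfold sums with at most one nonzero term *)

Section Sums.
Variables (I : eqType) (V : nmodType).

Lemma big_seq_only (s : seq I) (a : I) (T : I -> V) :
  uniq s -> a \in s -> (forall x, x \in s -> x != a -> T x = 0) ->
  \sum_(x <- s) T x = T a.
Proof.
move=> us sa T0; rewrite (bigD1_seq a)//= big_seq_cond big1 ?addr0// => x.
by case/andP; exact: T0.
Qed.

Lemma big_seq4_0 (s1 s2 s3 s4 : seq I) (T : I -> I -> I -> I -> V) :
  (forall u v x y, u \in s1 -> v \in s2 -> x \in s3 -> y \in s4 ->
    T u v x y = 0) ->
  \sum_(u <- s1) \sum_(v <- s2) \sum_(x <- s3) \sum_(y <- s4) T u v x y = 0.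
Proof.
move=> T0; rewrite big_seq big1// => u us.
rewrite big_seq big1// => v vs; rewrite big_seq big1// => x xs.
by rewrite big_seq big1// => y ys; exact: T0.
Qed.

Lemma big_seq4_only (s1 s2 s3 s4 : seq I) (u0 v0 x0 y0 : I)
    (T : I -> I -> I -> I -> V) :
  uniq s1 -> uniq s2 -> uniq s3 -> uniq s4 ->
  u0 \in s1 -> v0 \in s2 -> x0 \in s3 -> y0 \in s4 ->
  (forall u v x y, u \in s1 -> v \in s2 -> x \in s3 -> y \in s4 ->
    T u v x y != 0 -> [/\ u = u0, v = v0, x = x0 & y = y0]) ->
  \sum_(u <- s1) \sum_(v <- s2) \sum_(x <- s3) \sum_(y <- s4) T u v x y =
  T u0 v0 x0 y0.
Proof.
move=> us1 us2 us3 us4 u0s v0s x0s y0s T0.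
have T0' u v x y : u \in s1 -> v \in s2 -> x \in s3 -> y \in s4 ->
    [|| u != u0, v != v0, x != x0 | y != y0] -> T u v x y = 0.
  move=> us vs xs ys ne; apply: contraTeq ne => /T0[]// -> -> -> ->.
  by rewrite !eqxx.
rewrite (big_seq_only us1 u0s).
  rewrite (big_seq_only us2 v0s).
    rewrite (big_seq_only us3 x0s).
      by rewrite (big_seq_only us4 y0s)// => y ys ny; rewrite T0'// ny !orbT.
    move=> x xs nx; rewrite big_seq big1// => y ys.
    by rewrite T0'// nx !orbT.
  move=> v vs nv; rewrite big_seq big1// => x xs.
  by rewrite big_seq big1// => y ys; rewrite T0'// nv !orbT.
move=> u us nu; rewrite big_seq big1// => v vs; rewrite big_seq big1// => x xs.
by rewrite big_seq big1// => y ys; rewrite T0'// nu.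
Qed.

End Sums.

(** * Discrete valuation and the projective line over o/p^2 *)

Section Valuation.
Variables (R : realType) (F : naLocalFieldType R) (varpi : F).
Hypothesis varpi_unif : uniformizer varpi.
Implicit Types x y c d : F.
Local Notation q := (absv varpi).

Lemma absv_gt0 x : (0 < absv x) = (x != 0).
Proof. by rewrite lt_neqAle absv_ge0 eq_sym absv_eq0 andbT. Qed.

Lemma absvX x n : absv (x ^+ n) = absv x ^+ n.
Proof.
by elim: n => [|n IH]; rewrite ?expr0 ?absv1// !exprS absvM IH.
Qed.

Lemma absvXz x (n : int) : absv (x ^ n) = absv x ^ n.
Proof.
case: n => n; first by rewrite -!exprnP absvX.
by rewrite NegzE -!exprnN absvV absvX.
Qed.

Lemma absvB_le x y (r : R) : absv x <= r -> absv y <= r -> absv (x - y) <= r.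
Proof. by move=> xr yr; rewrite absvD_le ?absvN. Qed.

Lemma absvB_lt x y (r : R) : absv x < r -> absv y < r -> absv (x - y) < r.
Proof. by move=> xr yr; rewrite absvD_lt ?absvN. Qed.

Lemma absv_distC x y : absv (x - y) = absv (y - x).
Proof. by rewrite -absvN opprB. Qed.

Lemma absv_addl_eq x y : absv y < absv x -> absv (x + y) = absv x.
Proof.
move=> yx; apply/eqP; rewrite eq_le absvD_le ?(ltW yx)//=.
rewrite leNgt; apply/negP => xyx.
by have := absvB_lt xyx yx; rewrite addrK ltxx.
Qed.

Let q_gt0 : 0 < q.
Proof. by rewrite absv_gt0 uniformizer_neq0. Qed.

Let q_lt1 : q < 1.
Proof. exact: absv_uniformizer. Qed.

(** Discreteness of the valuation: [varpi] generates the maximal ideal. *)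
Lemma absv_lt1_le x : absv x < 1 -> absv x <= q.
Proof.
move=> /(maxideal_div varpi_unif); rewrite absvM absvV ler_pdivrMl//.
by rewrite mulr1.
Qed.

Lemma fracidealP (n : int) x : fracideal varpi n x <-> absv x <= q ^ n.
Proof.
have p0 : varpi ^ n != 0 by rewrite expfz_neq0// uniformizer_neq0.
split=> [[y y1 <-]|xn].
  by rewrite absvM absvXz ler_piMr// exprz_ge0// absv_ge0.
exists (x / varpi ^ n); last by rewrite mulrCA mulfV// mulr1.
by rewrite /oring/= absvM absvV absvXz ler_pdivrMr ?exprz_gt0// mul1r.
Qed.

Lemma absv_uniformizerX_le n : q ^+ n <= 1.
Proof. by rewrite exprn_ile1 ?absv_ge0// ltW. Qed.

(** If [absv x < 1] then already [absv x <= q], so the square is at most [q ^+ 2 < q]. This parity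
    of valuations is what excludes the coset of [gchi]. *)
Lemma absv_neq_sqrt_uniformizer x : absv x ^+ 2 != q.
Proof.
apply/eqP => xq.
have x1 : absv x < 1.
  rewrite ltNge; apply/negP => x1; have := exprn_ege1 2 x1.
  by rewrite xq leNgt q_lt1.
have xle := absv_lt1_le x1.
have : q <= q ^+ 2 by rewrite -[leLHS]xq lerXn2r ?nnegrE ?absv_ge0.
by rewrite expr2 leNgt gtr_pMr// q_lt1.
Qed.

Section Representatives.
Variables A1 A2 : seq F.
Hypothesis A1_repr : representatives (@oring R F) (fracideal varpi 1) A1.
Hypothesis A2_repr : representatives (@oring R F) (fracideal varpi 2) A2.

(* [proj_form b c d x] is 0 modulo p^2 iff (c : d) is the point (1 : x), resp.
   (- varpi x : 1), of the projective line over o/p^2; these are all its points. *)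
Definition proj_seq (b : bool) : seq F := if b then A2 else A1.

Definition proj_form (b : bool) (c d x : F) : F :=
  if b then d - c * x else c + varpi * x * d.

Lemma proj_seq_uniq b : uniq (proj_seq b).
Proof. by case: b; [case: A2_repr|case: A1_repr]. Qed.

Lemma proj_seq_oring b x : x \in proj_seq b -> absv x <= 1.
Proof.
case: b; first by case: A2_repr => _ h _ _ /h.
by case: A1_repr => _ h _ _ /h.
Qed.

(** There are two disjoint charts. If c is a unit, x is d / c modulo p^2; otherwise d is a unit and
    x is - c / (varpi d) modulo p. On each chart the form of the other chart takes unit values, so
    it cannot be 0 modulo p^2. *)
Lemma proj_form_exists c d : absv c <= 1 -> absv d <= 1 ->
  absv c = 1 \/ absv d = 1 ->
  exists b x, [/\ x \in proj_seq b, absv (proj_form b c d x) <= q ^+ 2 &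
    forall b' x', x' \in proj_seq b' -> absv (proj_form b' c d x') <= q ^+ 2 ->
      b' = b /\ x' = x].
Proof.
move=> c1 d1 cd.
have q2_lt1 : q ^+ 2 < 1 by rewrite exprn_ilt1 ?absv_ge0.
have p0 := uniformizer_neq0 varpi_unif.
have lt1M (x y : F) : absv x < 1 -> absv y <= 1 -> absv (x * y) < 1.
  exact: absvM_lt1.
have [cE|cN] := eqVneq (absv c) 1.
  have c0 : c != 0 by rewrite -absv_gt0 cE.
  have [uA2 _ A2e A2u] := A2_repr.
  have [|a aA] := A2e (d / c); first by rewrite /oring/= absvM absvV cE invr1 mulr1.
  rewrite fracidealP -exprnP => ad.
  exists true, a; split=> //=.
    have -> : d - c * a = c * (d / c - a) by field.
    by rewrite absvM cE mul1r.
  move=> [] x xs /= h; last first.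
    have xo : absv x <= 1 by exact: (@proj_seq_oring false).
    move: (le_lt_trans h q2_lt1); rewrite absv_addl_eq ?cE ?ltxx//.
    by rewrite lt1M ?lt1M.
  split=> //; apply: A2u => //; rewrite fracidealP -exprnP.
  have -> : x - a = (d / c - a) - (d - c * x) / c by field.
  by rewrite absvB_le// absvM absvV cE invr1 mulr1.
have cl : absv c < 1 by rewrite lt_neqAle cN.
have dE : absv d = 1 by case: cd => // cE; rewrite cE eqxx in cN.
have d0 : d != 0 by rewrite -absv_gt0 dE.
have [uA1 _ A1e A1u] := A1_repr.
have [|a aA] := A1e (- (c / (varpi * d))).
  rewrite /oring/= absvN absvM absvV absvM dE mulr1 ler_pdivrMr// mul1r.
  exact: absv_lt1_le.
rewrite fracidealP expr1z => ad.
exists false, a; split=> //=.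
  have -> : c + varpi * a * d = - (varpi * d * (- (c / (varpi * d)) - a)).
    by field; rewrite p0 d0.
  by rewrite absvN !absvM dE mulr1 expr2 ler_pM2l.
move=> [] x xs /= h.
  have xo : absv x <= 1 by exact: (@proj_seq_oring true).
  move: (le_lt_trans h q2_lt1); rewrite absv_addl_eq ?dE ?ltxx// absvN.
  exact: lt1M.
split=> //; apply: A1u => //; rewrite fracidealP expr1z.
have -> : x - a = (- (c / (varpi * d)) - a) + (c + varpi * x * d) / (varpi * d).
  by field; rewrite p0 d0.
rewrite absvD_le// absvM absvV absvM dE mulr1 ler_pdivrMr//.
Qed.

End Representatives.

Lemma ounits_repr_exists (U : seq F) r :
  representatives (@ounits R F) (fracideal varpi 1) U -> absv r = 1 ->
  exists u, [/\ u \in U, absv (r - u) < 1 &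
    forall u', u' \in U -> absv (r - u') < 1 -> u' = u].
Proof.
move=> [_ _ Ue Uu] /Ue[u uU]; rewrite fracidealP expr1z => ru.
exists u; split=> //; first exact: le_lt_trans ru q_lt1.
move=> u' u'U ru'; apply: Uu => //; rewrite fracidealP expr1z.
have -> : u' - u = (r - u) - (r - u') by ring.
by rewrite absvB_le// absv_lt1_le.
Qed.

End Valuation.

(** * The multiplier of an element of GSp4 *)

Section Similitude.
Variable F : fieldType.
Implicit Types g h : GSp4 F.

(** The symplectic pairing of columns 0 and 3 of g, which gives the multiplier mu(g) as a polynomial
    in the entries. *)
Definition simil g : F :=
  g 0 0 * g 3 3 + g 1 0 * g 2 3 - g 2 0 * g 1 3 - g 3 0 * g 0 3.

Lemma similP g : g^T *m Jmx *m g = simil g *: Jmx.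
Proof.
have [_ [mu _ gJ]] := is_GSp4E (valP g); rewrite /= in gJ.
rewrite gJ; congr (_ *: _); move: gJ.
rewrite (mx4_eta g) /Jmx mx4T !mx4M mx4Z => /(@mx4_inj _ _ _ 0 3)/=.
rewrite (mulr1 mu) => <-; rewrite /simil; ring.
Qed.

(** Columns 1 and 2 form the other hyperbolic pair of [Jmx], so they pair to the same multiplier.
    This expression controls the middle block, as [simil] itself controls the outer one. *)
Lemma simil_col12 g :
  simil g = g 0 1 * g 3 2 + g 1 1 * g 2 2 - g 2 1 * g 1 2 - g 3 1 * g 0 2.
Proof.
have := similP g; move: (simil g) => m.
rewrite {1 2}(mx4_eta g) /Jmx mx4T !mx4M mx4Z => /(@mx4_inj _ _ _ 1 2)/=.
rewrite (mulr1 m) => <-; ring.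
Qed.

Lemma simil_unique g (m : F) : g^T *m Jmx *m g = m *: Jmx -> simil g = m.
Proof.
by rewrite similP => /matrixP/(_ 0 3); rewrite !mxE/= !mulr1.
Qed.

Lemma simil_neq0 g : simil g != 0.
Proof.
have [_ [mu mu0 gJ]] := is_GSp4E (valP g).
by rewrite (simil_unique gJ).
Qed.

Lemma similM g h : simil (g * h)%g = simil g * simil h.
Proof.
apply: simil_unique; rewrite GSp4_mulE trmx_mul.
have -> : (h^T *m g^T) *m Jmx *m (g *m h) = h^T *m (g^T *m Jmx *m g) *m h.
  by rewrite !mulmxA.
by rewrite similP -scalemxAr -scalemxAl similP scalerA.
Qed.

Lemma simil1 : simil (1%g : GSp4 F) = 1.
Proof. by apply: simil_unique; rewrite trmx1 mul1mx mulmx1 scale1r. Qed.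

Lemma similV g : simil (g^-1)%g = (simil g)^-1.
Proof.
by apply: (mulIf (simil_neq0 g)); rewrite -similM mulVg simil1 mulVf ?simil_neq0.
Qed.

(** Taking determinants in the defining relation gives the identity up to squares, which is enough
    for absolute values. *)
Lemma det_simil g : \det (g : 'M[F]_4) ^+ 2 = simil g ^+ 4.
Proof.
have J0 : \det (Jmx : 'M[F]_4) != 0.
  apply/eqP => J0; have /(congr1 determinant) := Jmx2 F.
  rewrite det_mulmx J0 mul0r det_scalar => /esym/eqP.
  by rewrite expf_eq0 oppr_eq0 oner_eq0.
have /(congr1 determinant) := similP g.
rewrite detZ !det_mulmx det_tr => E; apply: (mulIf J0); rewrite -E; ring.
Qed.

(** Since the square of [Jmx] is -1, the inverse is - mu^-1 J g^T J. Its entries are those of g up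
    to sign, permuted and divided by the multiplier, so bounds on entries pass to the inverse. *)
Lemma GSp4_invE g : (g^-1)%g =
  (- (simil g)^-1) *: mx4
    [:: [:: - g 3 3; - g 2 3; g 1 3; g 0 3];
        [:: - g 3 2; - g 2 2; g 1 2; g 0 2];
        [:: g 3 1; g 2 1; - g 1 1; - g 0 1];
        [:: g 3 0; g 2 0; - g 1 0; - g 0 0]] :> 'M[F]_4.
Proof.
have E : ((- (simil g)^-1) *: (Jmx *m g^T *m Jmx)) *m g = 1%:M.
  rewrite -scalemxAl -!mulmxA [_ *m (_ *m (g : 'M[F]_4))]mulmxA similP -scalemxAr.
  rewrite Jmx2 scalerA scale_scalar_mx mulNr mulVf ?simil_neq0//.
  by rewrite mulrNN mulr1.
have [gu _] := is_GSp4E (valP g).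
transitivity ((- (simil g)^-1) *: (Jmx *m (g : 'M[F]_4)^T *m Jmx)).
  by rewrite -[RHS]mulmx1 -(mulmxV gu) mulmxA E mul1mx.
congr (_ *: _); rewrite [in LHS](mx4_eta g) /Jmx mx4T !mx4M; mx4_eq; ring.
Qed.

Lemma GSp4_prod_entry g h i j : (g * h)%g i j =
  g i 0 * h 0 j + g i 1 * h 1 j + g i 2 * h 2 j + g i 3 * h 3 j.
Proof.
rewrite GSp4_mulE mxE !big_ord_recl big_ord0 addr0 !addrA.
by do ![congr (_ + _)]; congr (_ * _); congr ((_ : 'M[F]_4) _ _); exact: val_inj.
Qed.

End Similitude.

Lemma ord4P (P : 'I_4 -> Prop) : P 0 -> P 1 -> P 2 -> P 3 -> forall i, P i.
Proof.
move=> P0 P1 P2 P3 [[|[|[|[|//]]]] i4].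
- by rewrite (_ : Ordinal i4 = 0)//; exact: val_inj.
- by rewrite (_ : Ordinal i4 = 1)//; exact: val_inj.
- by rewrite (_ : Ordinal i4 = 2)//; exact: val_inj.
- by rewrite (_ : Ordinal i4 = 3)//; exact: val_inj.
Qed.

(** * The paramodular group is closed under products and inverses *)

Section Paramodular.
Variables (R : realType) (F : naLocalFieldType R) (varpi : F).
Hypothesis varpi_unif : uniformizer varpi.
Local Notation G := (GSp4 F).
Local Notation q := (absv varpi).
Local Notation K5 := (paramodular varpi 5).
Implicit Types g k m : G.

Lemma absv_simil_det g : absv (\det (g : 'M[F]_4)) = absv (simil g) ^+ 2.
Proof.
apply/eqP; rewrite -(@eqrXn2 _ 2) ?absv_ge0 ?exprn_ge0 ?absv_ge0//.
by rewrite -exprM -!absvX det_simil.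
Qed.

Lemma paramodularP k : K5 k <->
  (forall i j : 'I_4, absv (k i j) <= q ^ paramodular_exp 5 i j)
  /\ absv (simil k) = 1.
Proof.
rewrite /paramodular /ounits/= absv_simil_det; split=> -[kb k1]; split.
- by move=> i j; apply/fracidealP.
- by apply/eqP; rewrite -(@eqrXn2 _ 2) ?absv_ge0// k1 expr1n.
- by move=> i j; apply/fracidealP.
- by rewrite k1 expr1n.
Qed.

Let q_gt0 : 0 < q.
Proof. by rewrite absv_gt0 uniformizer_neq0. Qed.

Let q_le1 : q <= 1.
Proof. by rewrite ltW// absv_uniformizer. Qed.

Lemma absv_uniformizerXz_le (a b : int) : a <= b -> q ^ b <= q ^ a.
Proof.
rewrite -subr_ge0 -(subrK a b) addrK; case: (b - a) => // n _.
rewrite expfzDr ?gt_eqF// ler_piMl ?exprz_ge0 ?absv_ge0//.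
by rewrite -exprnP exprn_ile1 ?absv_ge0.
Qed.

(** This inequality on exponents makes the matrices with entries in the given fractional ideals
    closed under multiplication. *)
Lemma paramodular_exp_triangle (i k j : 'I_4) :
  paramodular_exp 5 i j <= paramodular_exp 5 i k + paramodular_exp 5 k j.
Proof. by move: i k j; do 3!apply: ord4P. Qed.

Lemma paramodularM k k' : K5 k -> K5 k' -> K5 (k * k')%g.
Proof.
rewrite !paramodularP => -[kb k1] [k'b k'1]; split; last first.
  by rewrite similM absvM k1 k'1 mulr1.
move=> i j; rewrite GSp4_prod_entry.
have le l : absv (k i l * k' l j) <= q ^ paramodular_exp 5 i j.
  rewrite absvM.
  apply: (@le_trans _ _ (q ^ paramodular_exp 5 i l * q ^ paramodular_exp 5 l j)).
    by apply: ler_pM; rewrite ?absv_ge0.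
  rewrite -expfzDr ?gt_eqF// absv_uniformizerXz_le//.
  exact: paramodular_exp_triangle.
by do 3?[apply: absvD_le]; exact: le.
Qed.

Lemma paramodularV k : K5 k -> K5 (k^-1)%g.
Proof.
rewrite !paramodularP => -[kb k1]; split; last first.
  by rewrite similV absvV k1 invr1.
by do 2!apply: ord4P; rewrite GSp4_invE !mxE/= absvM absvN absvV k1 invr1 mul1r
  ?absvN; apply: kb.
Qed.

End Paramodular.

(** * Scalar matrices and the products d m delta *)

Section Scalar.
Variable F : fieldType.

Definition scalarG (c : F) : GSp4 F := toGSp4 c%:M.

Lemma scalarGE (c : F) : c != 0 -> scalarG c = c%:M :> 'M[F]_4.
Proof.
move=> c0; apply/toGSp4K/(@is_GSp4I _ _ (c ^+ 2)); first by rewrite expf_neq0.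
by rewrite tr_scalar_mx mul_scalar_mx mul_mx_scalar scalerA expr2.
Qed.

Lemma scalarG_center (c : F) : c != 0 -> centerG (scalarG c).
Proof.
move=> c0 g; apply: val_inj; rewrite /= scalarGE//.
by rewrite mul_scalar_mx mul_mx_scalar.
Qed.

Lemma simil_scalar (z : GSp4 F) (c : F) :
  z = c%:M :> 'M[F]_4 -> simil z = c ^+ 2.
Proof. by move=> zE; rewrite /simil zE !mxE/=; ring. Qed.

(** Row i is scaled by [varpi ^+ (3 - i)] and column j by [varpi ^+ j]; the truncated subtraction is
    exact because i is at most 3. *)
Lemma dvarpi_delta_entry (varpi : F) (m : GSp4 F) (i j : 'I_4) : varpi != 0 ->
  (dvarpi varpi * m * delta varpi)%g i j = varpi ^+ (3 - i + j) * m i j.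
Proof.
move=> p0; move: i j; do 2!apply: ord4P; rewrite !GSp4_prod_entry;
  by rewrite dvarpiE// deltaE// !mxE/=; ring.
Qed.

Lemma dvarpi_delta (varpi : F) : varpi != 0 ->
  (dvarpi varpi * delta varpi)%g = scalarG (varpi ^+ 3).
Proof.
move=> p0; apply: val_inj; rewrite /= scalarGE ?expf_neq0//.
by rewrite dvarpiE// deltaE// mx4M; mx4_tac; rewrite ?mulr1n ?mulr0n; ring.
Qed.

End Scalar.

(** * The intersection of K(p^5) with d^-1 H' d *)

Section Intersection.
Variables (R : realType) (F : naLocalFieldType R) (varpi : F) (t : F).
Hypothesis varpi_unif : uniformizer varpi.
Hypothesis t_unit : ounits t.
Local Notation G := (GSp4 F).
Local Notation q := (absv varpi).
Local Notation K5 := (paramodular varpi 5).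
Implicit Types g k m : G.

Let p0 : varpi != 0. Proof. exact: uniformizer_neq0. Qed.
Let q_gt0 : 0 < q. Proof. by rewrite absv_gt0. Qed.
Let q_lt1 : q < 1. Proof. exact: absv_uniformizer. Qed.

Lemma Hgrp_scaled (h : G) (c : F) : c != 0 ->
  (forall i j : 'I_4, if i == j then absv (c^-1 * h i j - 1) < 1
    else if (i < j)%N then absv (c^-1 * h i j) <= 1
    else absv (c^-1 * h i j) < 1) ->
  Hgrp h.
Proof.
move=> c0 hK; exists (scalarG c); first exact: scalarG_center.
exists ((scalarG c)^-1 * h)%g; last by rewrite mulVKg.
have E : c *: (((scalarG c)^-1 * h)%g : 'M[F]_4) = h.
  by rewrite -mul_scalar_mx -scalarGE// -GSp4_mulE mulVKg.
have E' i j : c^-1 * h i j = ((scalarG c)^-1 * h)%g i j.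
  by rewrite -{1}E [X in _ * X]mxE mulKf.
by move=> i j; have := hK i j; rewrite E'; case: (i == j) => //; case: ifP.
Qed.

Lemma absv_simil_Kprime k : Kprime k -> absv (simil k) = 1.
Proof.
move=> kK; have k00 := absv_1Dmax (kK 0 0); have k33 := absv_1Dmax (kK 3 3).
have := kK 1 0; have := kK 2 0; have := kK 3 0.
have := kK 2 3; have := kK 1 3; have := kK 0 3.
rewrite /maxideal /oring /= => k03 k13 k23 k30 k20 k10.
rewrite /simil -!addrA absv_addl_eq absvM k00 k33 mulr1//.
by rewrite absvD_lt ?absvM_lt1// absvB_lt ?absvN ?absvM_lt1.
Qed.

(* For m in K(p^5): membership in d^-1 H d, where d = [dvarpi varpi]. *)
Definition conjH m : Prop :=
  [/\ absv (m 2 1) <= q ^+ 2, absv (m 0 3) <= q ^- 3,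
      absv (m 0 0 - m 3 3) < 1, absv (m 1 1 - m 3 3) < 1
    & absv (m 2 2 - m 3 3) < 1].

Lemma absv_simil_dvarpi_delta m :
  absv (simil (dvarpi varpi * m * delta varpi)%g) = q ^+ 6 * absv (simil m).
Proof.
rewrite !similM {1 3}/simil dvarpiE// deltaE// !mxE/= -absvX -absvM.
by congr absv; ring.
Qed.

Lemma absv_simil_gchi : absv (simil (gchi varpi t)) = q.
Proof.
have t0 : t != 0 by rewrite -absv_gt0 t_unit.
rewrite /simil gchiE// !mxE/=.
rewrite -[RHS]mulr1 -[1 in RHS]invr1 -t_unit -absvV -absvM -absvN.
by congr absv; ring.
Qed.

(** Comparing multipliers rules out the coset of [gchi] and shows that the central factor c has
    absolute value [q ^+ 3]. The conditions are then read off entry by entry from varpi^(3 - i + j)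
    m_ij = c k_ij. *)
Lemma Hgrp'_conjH m : K5 m ->
  Hgrp' varpi t (dvarpi varpi * m * delta varpi)%g -> conjH m.
Proof.
rewrite paramodularP// => -[mb m1].
have sdm := absv_simil_dvarpi_delta m; rewrite m1 mulr1 in sdm.
move=> [[z zC [k kK zkE]]|[h [z zC [k kK <-]] gzkE]]; last first.
  have [c c0 zc] := centerG_scalar zC.
  move: sdm; rewrite -gzkE !similM !absvM absv_simil_gchi (simil_scalar zc).
  rewrite absv_simil_Kprime// mulr1 absvX => qc.
  (* The multiplier of [gchi] has valuation 1 and that of d m delta has valuation 6, so c^2 would
     have valuation 5. *)
  suff /eqP : absv (c / varpi ^+ 2) ^+ 2 = q.
    by rewrite (negPf (absv_neq_sqrt_uniformizer varpi_unif _)).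
  apply: (@mulfI _ q); first by rewrite gt_eqF.
  rewrite absvM absvV absvX expr_div_n mulrA qc -!exprM.
  by field; rewrite gt_eqF.
have [c c0 zc] := centerG_scalar zC.
have cq : absv c = q ^+ 3.
  apply/eqP; rewrite -(@eqrXn2 _ 2) ?absv_ge0 ?exprn_ge0 ?absv_ge0//.
  rewrite -exprM -sdm -zkE similM absvM (simil_scalar zc) absv_simil_Kprime//.
  by rewrite mulr1 absvX.
have mE (i j : 'I_4) : varpi ^+ (3 - i + j) * m i j = c * k i j.
  rewrite -dvarpi_delta_entry// -zkE GSp4_mulE zc mul_scalar_mx.
  by rewrite mxE.
have mE' (i j : 'I_4) : q ^+ (3 - i + j) * absv (m i j) = q ^+ 3 * absv (k i j).
  by rewrite -cq -absvM -mE absvM absvX.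
(* On the diagonal the exponent 3 - i + i is constantly 3, which cancels against c. *)
have dg (i : 'I_4) : absv (m i i - m 3 3) = absv (k i i - k 3 3).
  apply: (@mulfI _ (q ^+ 3)); first by rewrite expf_neq0// gt_eqF.
  rewrite -[in RHS]cq -absvM -absvX -absvM; congr absv.
  rewrite !mulrBr -!mE subnn; congr (_ * _ - _).
  by rewrite subnK// -ltnS ltn_ord.
have kdg (i : 'I_4) : absv (k i i - k 3 3) < 1.
  have := kK i i; have := kK 3 3; rewrite !eqxx /maxideal/= => k3 ki.
  have -> : k i i - k 3 3 = (k i i - 1) - (k 3 3 - 1) by ring.
  exact: absvB_lt.
have := kK 2 1; have := kK 0 3; rewrite /maxideal /oring/= => k03 k21.
split; rewrite ?dg//.
  have := mE' 2 1; rewrite /= subSn// subnn => E.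
  rewrite -(ler_pM2l (exprn_gt0 2 q_gt0)) E.
  have -> : q ^+ 2 * q ^+ 2 = q ^+ 3 * q by ring.
  by rewrite ler_pM2l ?exprn_gt0// absv_lt1_le.
have := mE' 0 3; rewrite /= subn0 => E.
rewrite -(ler_pM2l (exprn_gt0 6 q_gt0)) E.
rewrite (exprD _ 3 3) mulfK ?expf_neq0 ?gt_eqF//.
by rewrite ler_piMr// exprn_ge0// ltW.
Qed.

Lemma paramodular_le m (i j : 'I_4) : K5 m -> 0 <= paramodular_exp 5 i j ->
  absv (m i j) <= 1.
Proof.
rewrite paramodularP// => -[mb _] e0; apply: le_trans (mb i j) _.
by rewrite -(expr0z q) absv_uniformizerXz_le.
Qed.

Lemma paramodular_le5 m (i j : 'I_4) : K5 m -> paramodular_exp 5 i j = 5 ->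
  absv (m i j) <= q ^+ 5.
Proof. by rewrite paramodularP// => -[mb _] e5; have := mb i j; rewrite e5. Qed.

Lemma paramodular_lt m (i j : 'I_4) : K5 m -> paramodular_exp 5 i j = 5 ->
  absv (m i j) < 1.
Proof.
move=> mK /(paramodular_le5 mK) h; apply: le_lt_trans h _.
by rewrite exprn_ilt1 ?absv_ge0.
Qed.

(** The remaining terms of the multiplier are products of an entry in p^5 and an integral one. Hence
    the determinant of the middle block is the multiplier modulo p, and [paramodular_block03] gives
    the same for the outer block. *)
Lemma paramodular_block12 m : K5 m ->
  absv (m 1 1 * m 2 2 - m 2 1 * m 1 2 - simil m) < 1.
Proof.
move=> mK; rewrite (simil_col12 m).
have -> : m 1 1 * m 2 2 - m 2 1 * m 1 2 - (m 0 1 * m 3 2 + m 1 1 * m 2 2 -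
    m 2 1 * m 1 2 - m 3 1 * m 0 2) = m 3 1 * m 0 2 - m 3 2 * m 0 1 by ring.
have lt := paramodular_lt mK; have le := paramodular_le mK.
by rewrite absvB_lt// absvM_lt1 ?lt ?le.
Qed.

Lemma paramodular_block03 m : K5 m ->
  absv (m 0 0 * m 3 3 - m 3 0 * m 0 3 - simil m) < 1.
Proof.
move=> mK.
have -> : m 0 0 * m 3 3 - m 3 0 * m 0 3 - simil m =
    m 2 0 * m 1 3 - m 1 0 * m 2 3 by rewrite /simil; ring.
have lt := paramodular_lt mK; have le := paramodular_le mK.
by rewrite absvB_lt// absvM_lt1 ?lt ?le.
Qed.

(** The two bounds put the antidiagonal products of both blocks in p (m30 is in p^5 and m03 in
    p^-3). So both diagonal products are congruent to the unit multiplier, and their integral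
    factors are units. *)
Lemma paramodular_diag m : K5 m -> absv (m 2 1) <= q ^+ 2 ->
    absv (m 0 3) <= q ^- 3 ->
  [/\ forall i : 'I_4, absv (m i i) = 1
    & absv (m 0 0 * m 3 3 - m 1 1 * m 2 2) < 1].
Proof.
move=> mK m21 m03.
have q2_lt1 : q ^+ 2 < 1 by rewrite exprn_ilt1 ?absv_ge0.
have s1 : absv (simil m) = 1 by move: mK; rewrite paramodularP// => -[].
have le (i j : 'I_4) := @paramodular_le m i j mK.
have m2112 : absv (m 2 1 * m 1 2) < 1.
  by rewrite absvM_lt1 ?le// (le_lt_trans m21).
have m3003 : absv (m 3 0 * m 0 3) < 1.
  rewrite absvM; apply: (@le_lt_trans _ _ (q ^+ 5 * q ^- 3)).
    by rewrite ler_pM ?absv_ge0 ?paramodular_le5.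
  by rewrite (exprD _ 2 3) mulfK ?expf_neq0// gt_eqF.
have E12 : absv (m 1 1 * m 2 2 - simil m) < 1.
  have -> : m 1 1 * m 2 2 - simil m =
    (m 1 1 * m 2 2 - m 2 1 * m 1 2 - simil m) + m 2 1 * m 1 2 by ring.
  by rewrite absvD_lt ?paramodular_block12.
have E03 : absv (m 0 0 * m 3 3 - simil m) < 1.
  have -> : m 0 0 * m 3 3 - simil m =
    (m 0 0 * m 3 3 - m 3 0 * m 0 3 - simil m) + m 3 0 * m 0 3 by ring.
  by rewrite absvD_lt ?paramodular_block03.
have unit x : absv (x - simil m) < 1 -> absv x = 1.
  by move=> h; rewrite -[x](subrK (simil m)) addrC absv_addl_eq s1.
have unitM (x y : F) : absv x <= 1 -> absv y <= 1 -> absv (x * y) = 1 -> absv x = 1.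
  move=> x1 y1 xy; apply/eqP; rewrite eq_le x1/= leNgt; apply/negP => xlt.
  by have := absvM_lt1 xlt y1; rewrite xy ltxx.
split; last first.
  have -> : m 0 0 * m 3 3 - m 1 1 * m 2 2 =
    (m 0 0 * m 3 3 - simil m) - (m 1 1 * m 2 2 - simil m) by ring.
  exact: absvB_lt.
have /unit m0033 := E03; have /unit m1122 := E12.
apply: ord4P.
- by apply: (unitM _ (m 3 3)); rewrite ?le.
- by apply: (unitM _ (m 2 2)); rewrite ?le.
- by apply: (unitM _ (m 1 1)); rewrite ?le// mulrC.
- by apply: (unitM _ (m 0 0)); rewrite ?le// mulrC.
Qed.

Lemma conjH_Hgrp m : K5 m -> conjH m ->
  Hgrp (dvarpi varpi * m * delta varpi)%g.
Proof.
move=> mK [m21 m03 m00 m11 m22].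
have q3 : 0 < q ^+ 3 by rewrite exprn_gt0.
have mo (i j : 'I_4) := @paramodular_le m i j mK.
have m5 (i j : 'I_4) := @paramodular_le5 m i j mK.
have [mU _] := paramodular_diag mK m21 m03.
have m33 := mU 3.
have m33_neq0 : m 3 3 != 0 by rewrite -absv_gt0 m33.
(* The scalar is the (3, 3) entry of d m delta, so that after division this entry is 1. *)
apply: (@Hgrp_scaled _ (varpi ^+ 3 * m 3 3)).
  by rewrite mulf_neq0 ?expf_neq0.
have E (i j : 'I_4) (n : nat) :
    absv ((varpi ^+ 3 * m 3 3)^-1 * (varpi ^+ n * m i j)) =
    q ^- 3 * (q ^+ n * absv (m i j)).
  by rewrite !absvM absvV absvM m33 mulr1 !absvX.
have diag (i : 'I_4) : absv (m i i - m 3 3) < 1 ->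
    absv ((varpi ^+ 3 * m 3 3)^-1 * (varpi ^+ 3 * m i i) - 1) < 1.
  have -> : (varpi ^+ 3 * m 3 3)^-1 * (varpi ^+ 3 * m i i) - 1 =
      (m i i - m 3 3) / m 3 3 by field; rewrite p0 m33_neq0.
  by rewrite absvM absvV m33 invr1 mulr1.
have upper (i j : 'I_4) (n : nat) : absv (m i j) <= 1 ->
    q ^- 3 * (q ^+ (3 + n) * absv (m i j)) <= 1.
  move=> mij; rewrite (exprD _ 3 n) -(mulrA (q ^+ 3)) mulKf ?gt_eqF//.
  rewrite mulr_ile1 ?absv_ge0//.
    by rewrite exprn_ge0 ?absv_ge0.
  exact: absv_uniformizerX_le.
have lower (i j : 'I_4) (n : nat) : absv (m i j) <= q ^+ 5 ->
    q ^- 3 * (q ^+ n * absv (m i j)) < 1.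
  move=> mij; rewrite ltr_pdivrMl// mulr1.
  apply: (@le_lt_trans _ _ (1 * q ^+ 5)).
    by rewrite ler_pM ?absv_ge0 ?exprn_ge0 ?absv_ge0 ?absv_uniformizerX_le.
  by rewrite mul1r (exprD _ 2 3) gtr_pMl// exprn_ilt1 ?absv_ge0.
have m33' : absv (m 3 3 - m 3 3) < 1 by rewrite subrr absv0.
have h03 : q ^- 3 * (q ^+ 6 * absv (m 0 3)) <= 1.
  rewrite ler_pdivrMl// mulr1 (exprD _ 3 3) -mulrA ler_piMr ?(ltW q3)//.
  by rewrite -ler_pdivlMl// mulr1.
have h21 : q ^- 3 * (q ^+ 2 * absv (m 2 1)) < 1.
  rewrite ltr_pdivrMl// mulr1.
  apply: (@le_lt_trans _ _ (q ^+ 2 * q ^+ 2)).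
    by rewrite ler_pM2l ?exprn_gt0.
  have -> : q ^+ 2 * q ^+ 2 = q ^+ 3 * q by ring.
  by rewrite gtr_pMr.
(* Below the diagonal every entry of m except (2, 1) lies in p^5, which outweighs the division by
   varpi^3. Above it every entry except (0, 3) is integral and carries an exponent of at least 3.
   The two exceptions are [h21] and [h03]. *)
do 2!apply: ord4P; rewrite dvarpi_delta_entry//=; try exact: diag; rewrite E.
all: first [exact: h21 | exact: h03 | by rewrite lower ?m5
  | by apply: (upper _ _ 1); rewrite mo | by apply: (upper _ _ 2); rewrite mo].
Qed.

End Intersection.

(** * The four cells represent the cosets, each exactly once *)

Section Representatives.
Variables (R : realType) (F : naLocalFieldType R) (varpi : F).
Hypothesis varpi_unif : uniformizer varpi.
Local Notation G := (GSp4 F).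
Local Notation q := (absv varpi).
Local Notation K5 := (paramodular varpi 5).
Implicit Types k m : G.

Let p0 : varpi != 0. Proof. exact: uniformizer_neq0. Qed.
Let q_gt0 : 0 < q. Proof. by rewrite absv_gt0. Qed.
Let q_lt1 : q < 1. Proof. exact: absv_uniformizer. Qed.

(* [a] selects the cell for the block of rows and columns 0 and 3, [b] the one
   for the block of rows and columns 1 and 2. *)
Definition cell_rep (a b : bool) (y x : F) : G :=
  (match a, b with
   | true, true => w1 F * unip (y * varpi ^- 5) * ell x
   | true, false => unip (y * varpi ^- 5) * ell (x * varpi)
   | false, true => w2 varpi * unip (y * varpi ^- 4) * ell x
   | false, false => w3 varpi * unip (y * varpi ^- 4) * ell (x * varpi)
   end)%g.

Lemma cell_repE a b y x : cell_rep a b y x =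
  mx4 [:: [:: a%:R; 0; 0; if a then y * varpi ^- 5 else - varpi ^- 5];
          [:: 0; if b then - x else 1; - b%:R; 0];
          [:: 0; if b then 1 else x * varpi; (~~ b)%:R; 0];
          [:: (~~ a)%:R * varpi ^+ 5; 0; 0; if a then 1 else y * varpi]]
  :> 'M[F]_4.
Proof.
case: a b => [] []; rewrite !GSp4_mulE ?w1E ?(w2E p0) ?(w3E p0) unipE ellE !mx4M;
  by mx4_eq; rewrite /=; field.
Qed.

Lemma simil_cell_rep a b y x : simil (cell_rep a b y x) = 1.
Proof. by rewrite /simil cell_repE !mxE/=; case: a => /=; field. Qed.

Lemma cell_rep_paramodular a b y x : absv x <= 1 -> absv y <= 1 ->
  K5 (cell_rep a b y x).
Proof.
move=> x1 y1; apply/paramodularP => //; split; last first.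
  by rewrite simil_cell_rep absv1.
have M_le (z w : F) : absv z <= 1 -> absv w <= 1 -> absv (z * w) <= 1.
  by move=> z1 w1; rewrite absvM mulr_ile1 ?absv_ge0.
do 2!apply: ord4P; rewrite cell_repE !mxE/=; case: a b => [] [] /=;
  rewrite ?(absv0, absv1, absvN, expr0z, mul0r, mul1r, mulr0n, mulr1n) ?absv_ge0//
    ?exprz_ge0 ?absv_ge0 ?M_le ?(ltW q_lt1)//.
all: try by rewrite absvX.
all: try by rewrite absvV absvX.
all: by rewrite absvM absvV absvX ler_piMl// invr_ge0 exprn_ge0 ?absv_ge0.
Qed.

Lemma torus_paramodular u v : ounits u -> ounits v -> K5 (torus u v).
Proof.
rewrite /ounits/= => u1 v1.
have u0 : u != 0 by rewrite -absv_gt0 u1.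
have v0 : v != 0 by rewrite -absv_gt0 v1.
apply/paramodularP => //; split; last first.
  by rewrite /simil torusE// !mxE/= !(mul0r, subr0, addr0, mulr1) absvM u1 v1 mulr1.
do 2!apply: ord4P; rewrite torusE// !mxE/=;
  by rewrite ?absv0 ?exprz_ge0 ?absv_ge0// ?absvM ?u1 ?v1 ?absv1 ?mulr1.
Qed.

(** If both entries were in p, so would be the determinant of the middle block, which is congruent
    to a unit. *)
Lemma paramodular_primitive12 k : K5 k ->
  absv (k 2 1) = 1 \/ absv (k 2 2) = 1.
Proof.
move=> kK; have := paramodular_block12 varpi_unif kK.
have le (i j : 'I_4) := paramodular_le varpi_unif (i := i) (j := j) kK.
have s1 : absv (simil k) = 1 by move: kK => /paramodularP-/(_ varpi_unif)[].
have [|c1] := eqVneq (absv (k 2 1)) 1; first by left.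
have [|d1] := eqVneq (absv (k 2 2)) 1; first by right.
have clt : absv (k 2 1) < 1 by rewrite lt_neqAle c1 le.
have dlt : absv (k 2 2) < 1 by rewrite lt_neqAle d1 le.
rewrite addrC absv_addl_eq absvN s1 ?ltxx//.
by rewrite absvB_lt// ?[k 1 1 * _]mulrC absvM_lt1 ?le.
Qed.

(** The argument for the middle block applies to the outer one once k03 is multiplied and k30
    divided by varpi^5, which makes that block integral. The sign is the one that fits [proj_form]
    in [absv_cell_03]. *)
Lemma paramodular_primitive03 k : K5 k ->
  absv (k 0 0) = 1 \/ absv (- (k 0 3 * varpi ^+ 5)) = 1.
Proof.
move=> kK; have := paramodular_block03 varpi_unif kK.
have le (i j : 'I_4) := paramodular_le varpi_unif (i := i) (j := j) kK.
have [kb s1] : (forall i j : 'I_4, absv (k i j) <= q ^ paramodular_exp 5 i j)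
    /\ absv (simil k) = 1 by apply/paramodularP.
have [|c1] := eqVneq (absv (k 0 0)) 1; first by left.
have [|d1] := eqVneq (absv (- (k 0 3 * varpi ^+ 5))) 1; first by right.
have clt : absv (k 0 0) < 1 by rewrite lt_neqAle c1 le.
have dlt : absv (k 0 3 * varpi ^+ 5) < 1.
  rewrite -absvN lt_neqAle d1 absvN absvM absvX.
  by rewrite -ler_pdivlMr ?exprn_gt0// mul1r; exact: (kb 0 3).
rewrite addrC absv_addl_eq absvN s1 ?ltxx//.
apply: absvB_lt; first by rewrite absvM_lt1 ?le.
have -> : k 3 0 * k 0 3 = k 0 3 * varpi ^+ 5 * (k 3 0 / varpi ^+ 5) by field.
rewrite absvM_lt1// absvM absvV absvX ler_pdivrMr ?exprn_gt0// mul1r.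
exact: (kb 3 0).
Qed.

(** The (2, 1) entry depends only on the cell data b, x and the (0, 3) entry only on a, y. Thus the
    first two conditions of [conjH] become independent equations for two points of the projective
    line over o/p^2. *)
Lemma absv_cell_21 k a b y x :
  absv ((k * cell_rep a b y x)%g 2 1) =
  absv (proj_form varpi b (k 2 1) (k 2 2) x).
Proof.
rewrite GSp4_prod_entry cell_repE !mxE/=.
by congr absv; case: b => /=; ring.
Qed.

Lemma absv_cell_03 k a b y x :
  absv ((k * cell_rep a b y x)%g 0 3) =
  q ^- 5 * absv (proj_form varpi a (k 0 0) (- (k 0 3 * varpi ^+ 5)) y).
Proof.
rewrite -absvX -absvV -absvM -absvN GSp4_prod_entry cell_repE !mxE/=.
by congr absv; case: a => /=; field.
Qed.

Lemma conjH_torus k u v : absv u = 1 -> absv v = 1 ->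
  conjH varpi (k * torus u v)%g <->
  [/\ absv (k 2 1) <= q ^+ 2, absv (k 0 3) <= q ^- 3,
      absv (k 0 0 * (u * v) - k 3 3) < 1, absv (k 1 1 * u - k 3 3) < 1
    & absv (k 2 2 * v - k 3 3) < 1].
Proof.
move=> u1 v1.
have u0 : u != 0 by rewrite -absv_gt0 u1.
have v0 : v != 0 by rewrite -absv_gt0 v1.
rewrite /conjH !GSp4_prod_entry torusE// !mxE/=.
rewrite !(mulr0, add0r, addr0, mulr1).
by rewrite (absvM (k 2 1)) u1 mulr1.
Qed.

(** The conditions on k11 and k22 fix u and v as the classes of k33 / k11 and k33 / k22. The one on
    k00 then follows, because k00 k33 and k11 k22 agree modulo p. *)
Lemma conjH_torus_exists (U : seq F) k :
    representatives (@ounits R F) (fracideal varpi 1) U ->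
    K5 k -> absv (k 2 1) <= q ^+ 2 -> absv (k 0 3) <= q ^- 3 ->
  exists u v, [/\ u \in U, v \in U, conjH varpi (k * torus u v)%g &
    forall u' v', u' \in U -> v' \in U ->
      conjH varpi (k * torus u' v')%g -> u' = u /\ v' = v].
Proof.
move=> U_repr kK k21 k03; have [kU kD] := paramodular_diag varpi_unif kK k21 k03.
have U1 u : u \in U -> absv u = 1 by case: U_repr => _ h _ _ /h.
have k_neq0 (i : 'I_4) : k i i != 0 by rewrite -absv_gt0 kU.
have r1 (i : 'I_4) : absv (k 3 3 / k i i) = 1 by rewrite absvM absvV !kU invr1 mulr1.
have rE (i : 'I_4) x : absv (k i i * x - k 3 3) = absv (k 3 3 / k i i - x).
  rewrite absv_distC -[RHS]mul1r -(kU i) -absvM; congr absv.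
  by field; exact: k_neq0.
have [u [uU ru uniq_u]] := ounits_repr_exists varpi_unif U_repr (r1 1).
have [v [vU rv uniq_v]] := ounits_repr_exists varpi_unif U_repr (r1 2).
exists u, v; split=> //; last first.
  move=> u' v' u'U v'U; rewrite (conjH_torus _ (U1 _ u'U) (U1 _ v'U)) => -[_ _ _].
  by rewrite !rE => ru' rv'; split; [exact: uniq_u|exact: uniq_v].
rewrite (conjH_torus _ (U1 _ uU) (U1 _ vU)) !rE; split=> //.
(* Multiplying by the unit k11 k22 clears denominators and lets the quantity be written as a
   combination of the three congruences. *)
suff : absv (k 1 1 * k 2 2 * (k 0 0 * (u * v) - k 3 3)) < 1.
  by rewrite absvM (absvM (k 1 1)) !kU !mul1r rE.
have -> : k 1 1 * k 2 2 * (k 0 0 * (u * v) - k 3 3) =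
    (k 0 0 * k 3 3 - k 1 1 * k 2 2) * k 3 3
    + (k 2 2 * v - k 3 3) * (k 0 0 * (k 1 1 * u))
    + (k 1 1 * u - k 3 3) * (k 0 0 * k 3 3) by ring.
have kM (i j : 'I_4) : absv (k i i * k j j) = 1 by rewrite absvM !kU mulr1.
have kUu : absv (k 0 0 * (k 1 1 * u)) = 1 by rewrite !absvM !kU U1// !mulr1.
apply: absvD_lt; first apply: absvD_lt.
- by rewrite absvM_lt1// kU.
- by rewrite absvM_lt1 ?rE// kUu.
- by rewrite absvM_lt1 ?rE// kM.
Qed.

Variables U A1 A2 : seq F.
Hypothesis U_repr : representatives (@ounits R F) (fracideal varpi 1) U.
Hypothesis A1_repr : representatives (@oring R F) (fracideal varpi 1) A1.
Hypothesis A2_repr : representatives (@oring R F) (fracideal varpi 2) A2.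
Local Notation pseq := (proj_seq A1 A2).

(** Row 2 of the middle block of k determines (b, x) and row 0 of its outer block determines (a, y).
    Once k is multiplied by that cell representative, the diagonal determines (u, v). *)
Lemma conjH_rep_exists k : K5 k ->
  exists a b u v x y, [/\ u \in U, v \in U, x \in pseq b & y \in pseq a] /\
    conjH varpi (k * (cell_rep a b y x * torus u v))%g /\
    forall a' b' u' v' x' y',
      u' \in U -> v' \in U -> x' \in pseq b' -> y' \in pseq a' ->
      conjH varpi (k * (cell_rep a' b' y' x' * torus u' v'))%g ->
      [/\ a' = a, b' = b, u' = u & v' = v] /\ x' = x /\ y' = y.
Proof.
move=> kK.
have le (i j : 'I_4) := paramodular_le varpi_unif (i := i) (j := j) kK.
have U1 u : u \in U -> absv u = 1 by case: U_repr => _ h _ _ /h.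
have [b [x [xb fx uniq_x]]] := proj_form_exists varpi_unif A1_repr A2_repr
  (le 2 1 isT) (le 2 2 isT) (paramodular_primitive12 kK).
have d1 : absv (- (k 0 3 * varpi ^+ 5)) <= 1.
  have [kb _] : (forall i j : 'I_4, absv (k i j) <= q ^ paramodular_exp 5 i j)
    /\ absv (simil k) = 1 by apply/paramodularP.
  rewrite absvN absvM absvX -ler_pdivlMr ?exprn_gt0// mul1r; exact: (kb 0 3).
have [a [y [ya fy uniq_y]]] := proj_form_exists varpi_unif A1_repr A2_repr
  (le 0 0 isT) d1 (paramodular_primitive03 kK).
have f03 r : (q ^- 5 * r <= q ^- 3) = (r <= q ^+ 2).
  rewrite ler_pdivrMl ?exprn_gt0// (exprD _ 2 3) mulfK ?expf_neq0//.
  by rewrite gt_eqF.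
pose k1 := (k * cell_rep a b y x)%g.
have k1K : K5 k1.
  apply: paramodularM => //; apply: cell_rep_paramodular.
  - exact: (proj_seq_oring A1_repr A2_repr xb).
  - exact: (proj_seq_oring A1_repr A2_repr ya).
have k1_21 : absv (k1 2 1) <= q ^+ 2 by rewrite absv_cell_21.
have k1_03 : absv (k1 0 3) <= q ^- 3 by rewrite absv_cell_03 f03.
have [u [v [uU vU k1uv uniq_uv]]] :=
  conjH_torus_exists U_repr k1K k1_21 k1_03.
exists a, b, u, v, x, y; split=> //; split; first by rewrite mulgA.
move=> a' b' u' v' x' y' u'U v'U x'b y'a; rewrite mulgA => mir.
have := mir; rewrite (conjH_torus _ (U1 _ u'U) (U1 _ v'U)).
rewrite absv_cell_21 absv_cell_03 f03.
move=> -[/(uniq_x _ _ x'b)[bE xE] /(uniq_y _ _ y'a)[aE yE] _ _ _].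
by move: mir; rewrite aE bE xE yE => /(uniq_uv _ _ u'U v'U)[-> ->].
Qed.

(** Among all indices of the four sums exactly one satisfies [conjH], so a single term f
    survives. *)
Lemma sum_conjH (V : nmodType) (f : V) (T : G -> V) k : K5 k ->
  (forall g, K5 g -> conjH varpi (k * g)%g -> T g = f) ->
  (forall g, K5 g -> ~ conjH varpi (k * g)%g -> T g = 0) ->
  let S a b := \sum_(u <- U) \sum_(v <- U) \sum_(x <- pseq b) \sum_(y <- pseq a)
    T (cell_rep a b y x * torus u v)%g in
  S true true + S true false + S false true + S false false = f.
Proof.
move=> kK T1 T0 S.
have [a [b [u [v [x [y [[uU vU xb ya] [mir uniq_mir]]]]]]]] := conjH_rep_exists kK.
have repK a' b' u' v' x' y' : u' \in U -> v' \in U -> x' \in pseq b' ->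
    y' \in pseq a' -> K5 (cell_rep a' b' y' x' * torus u' v')%g.
  have [_ U1 _ _] := U_repr => /U1 u'1 /U1 v'1.
  move=> /(proj_seq_oring A1_repr A2_repr) x'1 /(proj_seq_oring A1_repr A2_repr) y'1.
  apply: paramodularM => //; first exact: cell_rep_paramodular.
  exact: torus_paramodular.
have SE : S a b = f.
  rewrite /S (@big_seq4_only _ _ _ _ _ _ u v x y)//; last first.
  - move=> u' v' x' y' u'U v'U x'b y'a; apply: contraNP => ne.
    rewrite T0//; first exact: repK.
    by move=> /(uniq_mir _ _ _ _ _ _ u'U v'U x'b y'a)[[_ _ ? ?] [? ?]]; apply: ne.
  - exact: proj_seq_uniq A2_repr _.
  - exact: proj_seq_uniq A2_repr _.
  - by case: U_repr.
  - by case: U_repr.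
  by rewrite T1//; exact: repK.
have S0 a' b' : (a' != a) || (b' != b) -> S a' b' = 0.
  move=> ne; apply: big_seq4_0 => u' v' x' y' u'U v'U x'b y'a.
  rewrite T0//; first exact: repK.
  move=> /(uniq_mir _ _ _ _ _ _ u'U v'U x'b y'a)[[aE bE _ _] _].
  by rewrite aE bE !eqxx in ne.
move: SE S0; case: (a); case: (b) => SE S0;
  by rewrite SE !S0// ?addr0 ?add0r.
Qed.

End Representatives.

(** * Values of the newvector and the minimal vector *)

Section CompactInduction.
Variables (R : realType) (F : naLocalFieldType R).
Variables (H : set (GSp4 F)) (chi : GSp4 F -> R[i]).

Lemma cInd_fun_sum (I : Type) (s : seq I) (f : I -> cInd H chi) (g : GSp4 F) :
  (\sum_(i <- s) f i) g = \sum_(i <- s) f i g.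
Proof. exact: (big_morph (fun f : cInd H chi => f g)). Qed.

End CompactInduction.

Section Newvector.
Variables (R : realType) (F : naLocalFieldType R) (varpi : F).
Variables (psi : F -> R[i]) (t : F) (e : bool).
Hypothesis varpi_unif : uniformizer varpi.
Hypothesis psi_char : additive_character psi.
Hypothesis psi_oring : forall x, oring x -> psi x = 1.
Hypothesis t_unit : ounits t.
Variables fnew fmin : sigma_chi varpi psi t e.
Hypothesis fnewP : is_newvector fnew.
Hypothesis fminP : is_minimal_vector fmin.
Local Notation G := (GSp4 F).
Local Notation K5 := (paramodular varpi 5).
Local Notation H' := (Hgrp' varpi t).
Local Notation chi' := (chipm varpi psi t e).

Lemma sigma_chi_equiv (f : sigma_chi varpi psi t e) (h g : G) : H' h ->
  f (h * g)%g = chi' h * f g.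
Proof. by move=> hH; have /asboolP[-> //] := valP f. Qed.

Lemma Kprime1 : Kprime (1%g : G).
Proof.
move=> i j; rewrite /maxideal /oring/= mxE.
by case: eqVneq => _; rewrite ?subrr ?absv0 ?ltr01//; case: ifP.
Qed.

Lemma Hgrp_center (z : G) : centerG z -> Hgrp z.
Proof. by exists z => //; exists 1%g; [exact: Kprime1|exact: mulg1]. Qed.

Lemma chipm_center (z : G) : centerG z -> chi' z = 1.
Proof.
move=> zC; rewrite chipm_H; last exact: Hgrp_center.
rewrite -[z]mulg1 (chiE varpi_unif psi_char psi_oring t_unit zC Kprime1).
rewrite /psi0 /chi_arg !mxE/= mulr0 !addr0 mulr0 psi_oring//.
by rewrite /oring/= absv0.
Qed.

(** Put h = g k delta. Then g = h z d k^-1 with z the scalar varpi^-3, for which z d is the inverse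
    of delta. As the central character is trivial, both sides equal chi'(h). *)
Lemma fmin_fnew (g k : G) : K5 k -> H' (g * k * delta varpi)%g ->
  fmin (g * k * delta varpi)%g = fnew g.
Proof.
move=> kK hH; have [-> // _] := fminP; set h := (g * k * delta varpi)%g in hH *.
have p0 := uniformizer_neq0 varpi_unif.
have p3 : varpi ^- 3 != 0 by rewrite invr_eq0 expf_neq0.
pose z := scalarG (varpi ^- 3); have zC : centerG z := scalarG_center p3.
have zdd : (z * dvarpi varpi * delta varpi)%g = 1%g.
  rewrite -mulgA dvarpi_delta//; apply: val_inj; rewrite /= !scalarGE//.
    by rewrite -scalar_mxM mulVf// expf_neq0.
  by rewrite expf_neq0.
have zdE : (z * dvarpi varpi)%g = (delta varpi)^-1%g.
  by apply: (mulIg (delta varpi)); rewrite zdd mulVg.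
have -> : g = (h * (z * (1 * dvarpi varpi * k^-1)))%g.
  by rewrite mul1g !mulgA -(mulgA h) zdE /h mulgK mulgK.
rewrite sigma_chi_equiv// sigma_chi_equiv; last by left; exact: Hgrp_center.
have C1 : centerG (1%g : G) by move=> x; rewrite mul1g mulg1.
have H1 : H' 1%g by left; exact: Hgrp_center.
rewrite (fnewP.1 _ _ H1 (paramodularV varpi_unif kK)).
by rewrite (chipm_center zC) (chipm_center C1) !mulr1.
Qed.

End Newvector.

Theorem proposition2p15 (R : realType) (F : naLocalFieldType R)
    (varpi : F) (varpi_unif : uniformizer varpi)
    (psi : F -> R[i]) (psi_char : additive_character psi)
    (psi_oring : forall x, oring x -> psi x = 1)
    (psi_cond : exists2 x, fracideal varpi (-1) x & psi x != 1)
    (t : F) (t_unit : ounits t) (e : bool)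
    (fnew fmin : sigma_chi varpi psi t e)
    (fnewP : is_newvector fnew) (fminP : is_minimal_vector fmin)
    (U A1 A2 : seq F)
    (U_repr : representatives (@ounits R F) (fracideal varpi 1) U)
    (A1_repr : representatives (@oring R F) (fracideal varpi 1) A1)
    (A2_repr : representatives (@oring R F) (fracideal varpi 2) A2) :
  fnew =
    \sum_(u <- U) \sum_(v <- U) \sum_(x <- A2) \sum_(y <- A2)
      rtransl (w1 F * unip (y * varpi ^- 5) * ell x
               * torus u v * delta varpi)%g fmin
    + \sum_(u <- U) \sum_(v <- U) \sum_(x <- A1) \sum_(y <- A2)
      rtransl (unip (y * varpi ^- 5) * ell (x * varpi)
               * torus u v * delta varpi)%g fmin
    + \sum_(u <- U) \sum_(v <- U) \sum_(x <- A2) \sum_(z <- A1)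
      rtransl (w2 varpi * unip (z * varpi ^- 4) * ell x
               * torus u v * delta varpi)%g fmin
    + \sum_(u <- U) \sum_(v <- U) \sum_(x <- A1) \sum_(z <- A1)
      rtransl (w3 varpi * unip (z * varpi ^- 4) * ell (x * varpi)
               * torus u v * delta varpi)%g fmin.
Proof.
pose S a b : sigma_chi varpi psi t e := \sum_(u <- U) \sum_(v <- U)
  \sum_(x <- proj_seq A1 A2 b) \sum_(y <- proj_seq A1 A2 a)
    rtransl (cell_rep varpi a b y x * torus u v * delta varpi)%g fmin.
(* Once the two booleans are given, [cell_rep] and [proj_seq] compute to the explicit words and
   index lists of the statement. *)
suff : fnew = S true true + S true false + S false true + S false false by [].
apply/val_inj/funext => g.
have SE a b : S a b g = \sum_(u <- U) \sum_(v <- U)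
    \sum_(x <- proj_seq A1 A2 b) \sum_(y <- proj_seq A1 A2 a)
    fmin (g * (cell_rep varpi a b y x * torus u v) * delta varpi)%g.
  by do 4![rewrite cInd_fun_sum; apply: eq_bigr => ? _]; rewrite /= !mulgA.
rewrite -[LHS]/(fnew g).
rewrite -[RHS]/(S true true g + S true false g + S false true g
  + S false false g).
rewrite !SE.
have [[h [k [hH kK gE]]]|gN] := pselect (exists h k : GSp4 F,
  [/\ Hgrp' varpi t h, paramodular varpi 5 k & g = (h * dvarpi varpi * k)%g]).
  (* On the support g = h d k, equivariance pulls out the value at h. The term of k' is then
     governed by whether d (k k') delta lies in H', that is, by [conjH] of k k'. *)
  apply/esym; pose T k' := fmin (g * k' * delta varpi)%g.
  apply: (sum_conjH varpi_unif U_repr A1_repr A2_repr (T := T) kK).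
    move=> k' k'K mir; rewrite /T gE -!mulgA !(sigma_chi_equiv _ _ hH).
    congr (_ * _).
    rewrite !mulgA (fmin_fnew varpi_unif psi_char psi_oring t_unit fnewP fminP)//.
    left; rewrite -(mulgA (dvarpi varpi)).
    by apply: conjH_Hgrp => //; exact: paramodularM.
  move=> k' k'K mir; rewrite /T gE -!mulgA (sigma_chi_equiv _ _ hH) fminP.2 ?mulr0//.
  rewrite !mulgA -(mulgA (dvarpi varpi)) => /Hgrp'_conjH-/(_ varpi_unif t_unit).
  by move=> mir'; apply: mir; apply: mir'; exact: paramodularM.
have fnew0 : fnew g = 0.
  by rewrite fnewP.2// => h k hH kK gE; apply: gN; exists h, k.
have S0 a b : \sum_(u <- U) \sum_(v <- U)
    \sum_(x <- proj_seq A1 A2 b) \sum_(y <- proj_seq A1 A2 a)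
    fmin (g * (cell_rep varpi a b y x * torus u v) * delta varpi)%g = 0.
  apply: big_seq4_0 => u v x y uU vU xb ya.
  have [hH|hN] := pselect (Hgrp' varpi t
    (g * (cell_rep varpi a b y x * torus u v) * delta varpi)%g); last first.
    exact: fminP.2.
  (* Off the support of [fnew], a term whose argument lies in H' equals [fnew g], which is 0. *)
  rewrite (fmin_fnew varpi_unif psi_char psi_oring t_unit fnewP fminP)//.
  apply: paramodularM => //.
    by apply: cell_rep_paramodular; rewrite ?(proj_seq_oring A1_repr A2_repr xb)
      ?(proj_seq_oring A1_repr A2_repr ya).
  by have [_ U1 _ _] := U_repr; apply: torus_paramodular => //; exact: U1.
by rewrite !S0 !addr0.
Qed.
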